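(* Let $\mathcal{X}\subseteq\mathbb{R}^d$ be convex with mirror potential $\phi$ as in the context, let $\lambda>0$ and $N\in\mathbb{N}$, $N\ge1$. Let $\mathcal{D}$ be a data space, $\mathcal{Y}$ a label space, $h(x,\cdot):\mathcal{D}\to\mathbb{R}^m$ a function parameterized by $x\in\mathcal{X}$, $\ell:\mathbb{R}^m\times\mathcal{Y}\to\mathbb{R}$ a loss function, $\{(z_j,y_j)\}_{j=1}^n\subset\mathcal{D}\times\mathcal{Y}$, and set $$F(\mu)=\frac1n\sum_{j=1}^n\ell(h_\mu(z_j),y_j),\qquad h_\mu(\cdot)=\int h(x,\cdot)\,d\mu(x),\qquad \mu\in\mathcal{P}_2(\mathcal{X}).$$ Let $\mathcal{L}(\mu)=F(\mu)+\lambda\,\mathsf{Ent}(\mu)$ on $\mathcal{P}_2(\mathcal{X})$, with minimizer $\mu_*$, and let $\mathcal{L}^{(N)}(\mu^{(N)})=N\,\mathbb{E}_{\mathbf{X}\sim\mu^{(N)}}[F(\mu_{\mathbf{X}})]+\lambda\,\mathsf{Ent}(\mu^{(N)})$ for probability measures $\mu^{(N)}$ on $\mathcal{X}^N$, with minimizer $\mu_*^{(N)}$. Assume: (1) there exist constants $M_1,M_2>0$ such that for all $\mu,\mu'\in\mathcal{P}_2(\mathcal{X})$ and $x,x'\in\mathcal{X}$, the first variation $\frac{\delta F(\mu)}{\delta\mu}$ is differentiable with $\left\|\nabla\frac{\delta F(\mu)}{\delta\mu}(x)\right\|_{[\nabla^2\phi(x)]^{-1}}\le M_1$ and $$\left\|\nabla\tfrac{\delta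 F(\mu)}{\delta\mu}(x)-\nabla\tfrac{\delta F(\mu')}{\delta\mu}(x')\right\|_{[\nabla^2\phi(x')]^{-1}}\le M_2\left(\widetilde W_{2,\phi}(\mu,\mu')+\|\nabla\phi(x)-\nabla\phi(x')\|_{[\nabla^2\phi(x')]^{-1}}\right);$$ (2) $\ell(\cdot,y)$ is convex for every $y\in\mathcal{Y}$, and there exists $L>0$ such that $\ell(b,y)\le\ell(a,y)+\langle\nabla\ell(a,y),b-a\rangle+\frac L2\|b-a\|^2$ for all $a,b\in\mathbb{R}^m$, $y\in\mathcal{Y}$ (gradient in the first argument); (3) there exists $R>0$ such that $\mathbb{E}_{X\sim\mu_*}\|h(X,z)\|^2\le R^2$ for every $z\in\mathcal{D}$. Then $$\frac\lambda N\,\mathsf{KL}\left(\mu_*^{(N)}\,\|\,\mu_*^{\otimes N}\right)\le\frac1N\mathcal{L}^{(N)}(\mu_*^{(N)})-\mathcal{L}(\mu_* )\le\frac{LR^2}{2N}.$$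
   Context: $\mathcal{P}_2(\mathcal{X})$ is the set of Borel probability measures on $\mathcal{X}$ with finite second moment. Measures are identified with their Lebesgue densities; $\mathsf{Ent}(\mu)=\int\log\frac{d\mu}{dx}\,d\mu$ ($+\infty$ if not absolutely continuous), and similarly on $\mathcal{X}^N$; $\mathsf{KL}(\mu\|\nu)=\int\mu\log\frac\mu\nu$. Mirror potential (standing assumptions): $\phi:\mathcal{X}\to\mathbb{R}$ is thrice differentiable, strictly convex and of Legendre type, with $\|\nabla\phi(x)\|\to\infty$ and $\nabla^2\phi(x)\to\infty$ as $x\to\partial\mathcal{X}$; $\nabla\phi:\mathcal{X}\to\mathbb{R}^d$ is a bijection onto $\mathbb{R}^d$ and $\nabla^2\phi(x)\succ0$; and $\|[\nabla^2\phi(x)]^{1/2}-[\nabla^2\phi(x')]^{1/2}\|_{\mathsf F}\le C\|x-x'\|_2$ for some constant $C$ and all $x,x'\in\mathcal{X}$. First variation: a continuous function $\frac{\delta F(\mu)}{\delta\mu}:\mathcal{X}\to\mathbb{R}$ such that for every $\mu'\in\mathcal{P}_2(\mathcal{X})$, $\frac{d}{d\epsilon}F(\mu+\epsilon(\mu'-\mu))\big|_{\epsilon=0}=\int\frac{\delta F(\mu)}{\delta\mu}\,d(\mu'-\mu)$; unique up to an additive constant. Local dual norm: $\|u\|_{[\nabla^2\phi(x)]^{-1}}=\langle u,[\nabla^2\phi(x)]^{-1}u\rangle^{1/2}$. Divergence: $\widetilde W_{2,\phi}^2(\mu,\mu')=\inf_{\pi\in\Pi(\mu,\mu')}\int\|\nabla\phi(x)-\nabla\phi(x')\|^2_{[\nabla^2\phi(x')]^{-1}}\,d\pi(x,x')$,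 $\Pi(\mu,\mu')$ the set of couplings. For $\mathbf{x}=(x^1,\dots,x^N)\in\mathcal{X}^N$, $\mu_{\mathbf{x}}=\frac1N\sum_{i=1}^N\delta_{x^i}$ is the empirical measure. Standing assumption: $\mathcal{L}$ admits a minimizer $\mu_*$ over $\mathcal{P}_2(\mathcal{X})$; it is unique with $\mu_*\propto\exp(-\frac1\lambda\frac{\delta F(\mu_* )}{\delta\mu})$. The minimizer of $\mathcal{L}^{(N)}$ is the Gibbs distribution $\frac{d\mu_*^{(N)}}{d\mathbf{x}}(\mathbf{x})\propto\exp\left(-\frac N\lambda F(\mu_{\mathbf{x}})\right)$. *)

(* Defs.v *)
From HB Require Import structures.
From mathcomp Require Import all_boot all_order all_algebra.
From mathcomp Require Import all_classical all_reals all_analysis.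
From mathcomp Require Import measurable_realfun.

Set Implicit Arguments.
Unset Strict Implicit.
Unset Printing Implicit Defensive.

Import Order.TTheory GRing.Theory Num.Theory.
Import numFieldNormedType.Exports.

Local Open Scope classical_set_scope.
Local Open Scope ring_scope.

Definition borel_mx_display : measure_display.
Proof. exact: default_measure_display. Qed.

Section borel_mx.
Context {R : realType} {m n : nat}.

Definition borel_mx : set (set 'M[R]_(m, n)) := <<s [set A | open A] >>.

Let borel_mx0 : borel_mx set0. Proof. exact: sigma_algebra0. Qed.

Let borel_mxC A : borel_mx A -> borel_mx (~` A).
Proof. exact: sigma_algebraC. Qed.

Let borel_mx_bigcup (F : _^nat) :
  (forall i, borel_mx (F i)) -> borel_mx (\bigcup_i (F i)).
Proof. exact: sigma_algebra_bigcup. Qed.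

HB.instance Definition _ := @isMeasurable.Build borel_mx_display
  'M[R]_(m, n) borel_mx borel_mx0 borel_mxC borel_mx_bigcup.

End borel_mx.

Lemma open_measurable_mx (R : realType) m n (A : set 'M[R]_(m, n)) :
  open A -> measurable A.
Proof. by move=> oA; apply: sub_sigma_algebra. Qed.

Lemma sigma_finite_product_measure d d' (T : measurableType d)
    (T' : measurableType d') (R : realType)
    (mu : {sigma_finite_measure set T -> \bar R})
    (nu : {sigma_finite_measure set T' -> \bar R}) :
  sigma_finite setT (mu \x nu)%E.
Proof.
have /sigma_finiteP[F [TF ndF Foo]] := sigma_finiteT mu.
have /sigma_finiteP[G [TG ndG Goo]] := sigma_finiteT nu.
exists (fun n => F n `*` G n).
  rewrite -setXTT TF TG; apply/seteqP; split=> -[x y]; last first.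
    by move=> [n _ []/= ? ?]; split; exists n.
  move=> [/= [n _ Fnx] [k _ Gky]]; exists (maxn n k) => //; split.
  - by move: x Fnx; exact/subsetPset/ndF/leq_maxl.
  - by move: y Gky; exact/subsetPset/ndG/leq_maxr.
move=> k; have [? ?] := Foo k; have [? ?] := Goo k.
split; first exact: measurableX.
by rewrite product_measure1E// lte_mul_pinfty// ge0_fin_numE.
Qed.

(* The pushforward by a measurable [f] with a measurable left inverse; the proofs
   are arguments so that sigma-finiteness can be inferred. *)
Section image_measure.
Context d d' (T : measurableType d) (T' : measurableType d') (R : realType).
Variables (mu : {measure set T -> \bar R}) (f : T -> T')
  (g : T' -> T).
Hypotheses (sf_mu : sigma_finite setT mu) (mf : measurable_fun setT f) (mg : measurable_fun setT g)
  (fK : cancel f g).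

Definition image_measure of sigma_finite setT mu & measurable_fun setT f & measurable_fun setT g
  & cancel f g : set T' -> \bar R := pushforward mu f.

Let image := image_measure sf_mu mf mg fK.

Let image0 : image set0 = 0%E. Proof. exact: measure0. Qed.

Let image_ge0 A : (0 <= image A)%E. Proof. exact: measure_ge0. Qed.

Let image_sigma_additive : semi_sigma_additive image.
Proof. exact: measure_semi_sigma_additive. Qed.

HB.instance Definition _ := isMeasure.Build _ _ _ image
  image0 image_ge0 image_sigma_additive.

Let image_sigma_finite : sigma_finite setT image.
Proof.
have [F TF Foo] := sf_mu; exists (fun n => g @^-1` F n).
  by rewrite -preimage_bigcup -TF preimage_setT.
move=> n; have [mF muF] := Foo n; split.
  by rewrite -[X in measurable X]setTI; exact: mg.
rewrite /image /image_measure /pushforward -comp_preimage.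
by rewrite (_ : g \o f = id)//; apply/funext => x /=.
Qed.

HB.instance Definition _ := Measure_isSigmaFinite.Build _ _ _ image
  image_sigma_finite.

End image_measure.

Section power_measure.
Context d (T : measurableType d) (R : realType).
Variable mu : {sigma_finite_measure set T -> \bar R}.

Definition tuple_cons n (p : T * n.-tuple T) : n.+1.-tuple T :=
  [tuple of p.1 :: p.2].

Definition tuple_uncons n (t : n.+1.-tuple T) : T * n.-tuple T :=
  (tnth t ord0, [tuple of behead t]).

Lemma measurable_tuple_cons n : measurable_fun setT (@tuple_cons n).
Proof. exact: measurable_cons. Qed.

Lemma measurable_tuple_uncons n : measurable_fun setT (@tuple_uncons n).
Proof.
apply/measurable_fun_pairP; split; first exact: measurable_tnth.
exact: measurable_behead.
Qed.

Lemma tuple_consK n : cancel (@tuple_cons n) (@tuple_uncons n).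
Proof. by move=> [x t]; congr pair; apply/val_inj. Qed.

Fixpoint power_measure n : {sigma_finite_measure set (n.-tuple T) -> \bar R} :=
  match n with
  | 0 => \d_[tuple]
  | n'.+1 => image_measure (sigma_finite_product_measure mu (power_measure n'))
      (@measurable_tuple_cons n') (@measurable_tuple_uncons n') (@tuple_consK n')
  end.

End power_measure.

Section lebesgue_rV.
Context {R : realType} {d : nat}.

Definition row_of_tuple (t : d.-tuple (measurableTypeR R)) : 'rV[R]_d :=
  \row_i tnth t i.

Definition tuple_of_row (v : 'rV[R]_d) : d.-tuple (measurableTypeR R) :=
  [tuple v ord0 i | i < d].

Lemma row_of_tupleK : cancel row_of_tuple tuple_of_row.
Proof. by move=> t; apply: eq_from_tnth => i; rewrite tnth_mktuple mxE. Qed.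

Lemma measurable_tuple_of_row : measurable_fun setT tuple_of_row.
Proof.
apply/measurable_fun_tnthP => i.
apply: (measurability _ (RGenOpens.measurableE R)).
move=> _ [_ [a [b ->] <-]]; rewrite setTI; apply: open_measurable_mx.
rewrite (_ : _ \o _ = fun v : 'rV[R]_d => v ord0 i); last first.
  by apply/funext => v /=; rewrite tnth_mktuple.
apply: open_comp; last exact: interval_open.
by move=> v _; exact: coord_continuous.
Qed.

Lemma measurable_row_of_tuple : measurable_fun setT row_of_tuple.
Proof.
apply: (@measurability _ _ _ _ _ _ [set A : set 'rV[R]_d | open A]) => //.
move=> _ [U oU <-]; rewrite setTI.
pose c (q : 'rV[rat]_d) : 'rV[R]_d := map_mx ratr q.
pose I := [set i : 'rV[rat]_d * nat | ball (c i.1) i.2.+1%:R^-1 `<=` U].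
rewrite (_ : U = \bigcup_i if i \in I then ball (c i.1) i.2.+1%:R^-1 else set0).
  rewrite preimage_bigcup; apply: countable_bigcupT_measurable => // -[q n].
  case: ifPn => _; last by rewrite preimage_set0.
  rewrite (_ : _ @^-1` _ = \bigcap_(i : 'I_d)
      ((fun t => tnth t i) @^-1` ball (c q ord0 i) (n.+1%:R^-1 : R))).
    apply: fin_bigcap_measurable => // i _.
    rewrite -[X in measurable X]setTI; apply: measurable_tnth => //.
    by apply: open_measurable; apply: ball_open; rewrite invr_gt0.
  apply/seteqP; split => [t [_ tq] i _ /=|t tq].
    by have := tq ord0 i; rewrite [row_of_tuple t _ _]mxE.
  by split=> [|i j]; [rewrite invr_gt0|rewrite ord1 [row_of_tuple t _ _]mxE; exact: tq].
apply/seteqP; split => [v Uv|v [i _]]; last by case: ifPn => // /set_mem; exact.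
have /nbhs_ballP[e /= e0 veU] : nbhs v U by exact: open_nbhs_nbhs.
have [n /= ne] : exists n : nat, n.+1%:R^-1 < e / 2.
  have e20 : 0 < e / 2 by rewrite divr_gt0.
  exists (Num.truncn (e / 2)^-1); rewrite invf_plt ?posrE//.
  exact: truncnS_gt.
have q_ i : exists q : rat, `|v ord0 i - ratr q| < n.+1%:R^-1.
  have /rat_in_itvoo[q] : v ord0 i - n.+1%:R^-1 < v ord0 i + n.+1%:R^-1.
    by rewrite ltrBlDr -addrA ltrDl addr_gt0 ?invr_gt0.
  by rewrite in_itv /= => vq; exists q; rewrite distrC ltr_distl.
pose q : 'rV[rat]_d := \row_i sval (cid (q_ i)).
have vq : ball (c q) (n.+1%:R^-1 : R) v.
  split; first by rewrite invr_gt0.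
  move=> i j; rewrite ord1 /ball /= !mxE distrC; exact: svalP (cid (q_ j)).
exists (q, n) => //; rewrite ifT//; apply/mem_set => w qw; apply: veU.
apply: (@le_ball _ _ v (n.+1%:R^-1 + n.+1%:R^-1)).
  by rewrite (splitr e) lerD// ltW.
by apply: ball_triangle qw; exact: ball_sym.
Qed.

Definition lebesgue_rV : {sigma_finite_measure set 'rV[R]_d -> \bar R} :=
  image_measure (sigma_finiteT (power_measure (@lebesgue_measure R) d))
    measurable_row_of_tuple measurable_tuple_of_row row_of_tupleK.

End lebesgue_rV.

Section calculus.
Context {R : realType}.

(* Frobenius norm; on row vectors, the Euclidean norm.  The library norm
   [`|A|] on matrices is the max norm. *)
Definition norm2 m n (A : 'M[R]_(m, n)) : R :=
  Num.sqrt (\sum_i \sum_j A i j ^+ 2).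

Definition dot n (u v : 'rV[R]_n) : R := (u *m v^T) ord0 ord0.

Definition grad n (f : 'rV[R]_n -> R) (x : 'rV[R]_n) : 'rV[R]_n :=
  \row_i 'D_(delta_mx ord0 i) f x.

Definition hess n (f : 'rV[R]_n -> R) (x : 'rV[R]_n) : 'M[R]_n :=
  'J (grad f) x.

Definition psdmx n (A : 'M[R]_n) : Prop :=
  A^T = A /\ forall u : 'rV[R]_n, 0 <= dot (u *m A) u.

Definition pdmx n (A : 'M[R]_n) : Prop :=
  A^T = A /\ forall u : 'rV[R]_n, u != 0 -> 0 < dot (u *m A) u.

(* The positive semidefinite square root, and 0 if there is none. *)
Definition sqrtmx n (A : 'M[R]_n) : 'M[R]_n :=
  xget 0 [set B | psdmx B /\ B *m B = A].

(* Legendre type in the sense of Rockafellar, for the pair (X, phi): X is open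
   and convex, phi is differentiable and strictly convex on X, and its gradient
   blows up at every boundary point of X.  Convexity of X is stated apart.
   Only the values of [phi] on the open set [X] matter. *)
Record mirror_potential d (X : set 'rV[R]_d) (phi : 'rV[R]_d -> R) : Prop := {
  mirror_open : open X;
  mirror_diff1 : forall x, X x -> differentiable phi x;
  mirror_diff2 : forall x, X x -> differentiable (grad phi) x;
  mirror_diff3 : forall x, X x -> differentiable (hess phi) x;
  mirror_strict_convex : forall x y (t : R), X x -> X y -> x != y ->
    0 < t < 1 ->
    phi (t *: x + (1 - t) *: y) < t * phi x + (1 - t) * phi y;
  mirror_grad_infty : forall b, (closure X `\` X) b ->
    norm2 (grad phi x) @[x --> within X (nbhs b)] --> +oo;
  mirror_hess_infty : forall b, (closure X `\` X) b ->
    norm2 (hess phi x) @[x --> within X (nbhs b)] --> +oo;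
  mirror_bij : set_bij X setT (grad phi);
  mirror_hess_pd : forall x, X x -> pdmx (hess phi x);
  mirror_sqrt_lipschitz : exists C : R, forall x x', X x -> X x' ->
    norm2 (sqrtmx (hess phi x) - sqrtmx (hess phi x')) <= C * norm2 (x - x')
}.

Definition dual_norm d (phi : 'rV[R]_d -> R) (x u : 'rV[R]_d) : R :=
  Num.sqrt (dot u (u *m invmx (hess phi x))).

End calculus.

Section functionals.
Local Open Scope ereal_scope.
Local Open Scope charge_scope.
Context {R : realType}.

Section entropy.
Context d (T : measurableType d).
Implicit Types (nu : {sigma_finite_measure set T -> \bar R})
  (mu : probability T R).

(* The integral of f over mu is not of the form oo - oo, a case in which the
   library integral has the junk value -oo. *)
Definition integral_defined mu (f : T -> \bar R) : bool :=
  \int[mu]_x f^\+ x +? - \int[mu]_x f^\- x.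

Definition log_density nu mu (x : T) : \bar R :=
  (ln (fine ('d (charge_of_finite_measure mu) '/d nu x)))%:E.

(* Entropy of mu relative to nu: Ent(mu) when nu is the Lebesgue measure, and
   KL(mu || nu) when nu is a probability measure. *)
Definition entropy nu mu : \bar R :=
  if `[< mu `<< nu >] then \int[mu]_x log_density nu mu x else +oo.

Definition entropy_defined nu mu : Prop :=
  mu `<< nu -> integral_defined mu (log_density nu mu).

Definition KL mu nu : \bar R := entropy nu mu.

End entropy.

Section euclidean.
Context {d : nat}.
Implicit Types (X : set 'rV[R]_d) (mu : probability 'rV[R]_d R).

(* Probability measures on X are the probability measures on R^d which give
   mass 1 to X. *)
Definition P2 X mu : Prop :=
  mu X = 1 /\ \int[mu]_x (norm2 x ^+ 2)%:E < +oo.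

Definition coupling mu mu' (pi : probability ('rV[R]_d * 'rV[R]_d)%type R) :
    Prop :=
  forall A, measurable A ->
    pi (A `*` setT) = mu A /\ pi (setT `*` A) = mu' A.

Definition mirror_divergence X (phi : 'rV[R]_d -> R) mu mu' : \bar R :=
  sqrte (ereal_inf
    [set \int[pi]_(p in X `*` X)
           (dual_norm phi p.2 (grad phi p.1 - grad phi p.2) ^+ 2)%:E
    | pi in coupling mu mu']).

(* Meaningful for e in [0, 1]; the absolute values only provide signs. *)
Definition mixture (e : R) mu mu' : {measure set 'rV[R]_d -> \bar R} :=
  measure_add (mscale `|1 - e|%:nng%R mu) (mscale `|e|%:nng%R mu').

(* The derivative at 0 is from the right: mixtures are probability measures for
   e in [0, 1] only. *)
Definition first_variation X (F : {measure set 'rV[R]_d -> \bar R} -> R) mu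
    (V : 'rV[R]_d -> R) : Prop :=
  {within X, continuous V} /\
  forall mu', P2 X mu' ->
    [/\ mu.-integrable X (EFin \o V), mu'.-integrable X (EFin \o V) &
        (e^-1 * (F (mixture e mu mu') - F mu))%R @[e --> 0^'+] -->
          (\int[mu']_(x in X) V x - \int[mu]_(x in X) V x)%R].

Definition empirical N (x : N.-tuple 'rV[R]_d) :
    {measure set 'rV[R]_d -> \bar R} :=
  mscale (N%:R^-1)%:nng%R (msum (fun i => \d_(nth 0%R x i)) N).

Definition gibbs X (V : 'rV[R]_d -> R) mu : Prop :=
  exists2 Z : R, (0 < Z)%R & forall A, measurable A ->
    mu A = \int[lebesgue_rV]_(x in A `&` X) (expR (- V x) / Z)%:E.

Definition free_energy (F : {measure set 'rV[R]_d -> \bar R} -> R) (lam : R)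
    mu : \bar R :=
  (F mu)%:E + lam%:E * entropy lebesgue_rV mu.

Definition free_energy_minimizer X F lam mu : Prop :=
  P2 X mu /\
  forall mu', P2 X mu' -> free_energy F lam mu <= free_energy F lam mu'.

Section particles.
Variables (X : set 'rV[R]_d) (F : {measure set 'rV[R]_d -> \bar R} -> R)
  (lam : R) (N : nat).
Implicit Types muN : probability (N.-tuple 'rV[R]_d) R.

Let lebesgueN := power_measure (@lebesgue_rV R d) N.

Definition free_energyN muN : \bar R :=
  N%:R%:E * 'E_muN[fun x => F (empirical x)] +
  lam%:E * entropy lebesgueN muN.

(* Without second moments, the expectation, the entropy or their sum may be of
   the form oo - oo; such muN are not competitors for the minimum. *)
Definition free_energyN_defined muN : Prop :=
  [/\ integral_defined muN (fun x => (F (empirical x))%:E),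
      entropy_defined lebesgueN muN &
      N%:R%:E * 'E_muN[fun x => F (empirical x)] +?
        lam%:E * entropy lebesgueN muN].

Definition on_product muN : Prop :=
  muN [set x | forall i, X (tnth x i)] = 1.

Definition free_energyN_minimizer muN : Prop :=
  [/\ on_product muN, free_energyN_defined muN &
      forall muN', on_product muN' -> free_energyN_defined muN' ->
        free_energyN muN <= free_energyN muN'].

End particles.

End euclidean.

Section risk.
Context {d m n : nat} {D Y : Type}.
Variables (X : set 'rV[R]_d) (h : 'rV[R]_d -> D -> 'rV[R]_m).
Variables (l : 'rV[R]_m -> Y -> R) (z : 'I_n -> D) (y : 'I_n -> Y).

Definition mean_h (mu : {measure set 'rV[R]_d -> \bar R}) (w : D) : 'rV[R]_m :=
  \row_k (\int[mu]_(x in X) h x w ord0 k)%R.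

Definition risk (mu : {measure set 'rV[R]_d -> \bar R}) : R :=
  (n%:R^-1 * \sum_(j < n) l (mean_h mu (z j)) (y j))%R.

End risk.

End functionals.

(* Main.v *)
(* Convexity of F along the segment from mu_ to an empirical measure, together
   with mu_ = exp (- dF mu_ / lam) / Z, gives for every x in X^N
     N F (mu_x) >= N L (mu_) - lam \sum_i ln (mu_ x_i);
   integrating this against muN and adding lam Ent (muN) yields the lower bound,
   once all the integrals are known to be finite: the energy of muN is at most
   that of the product measure, and the negative part of
   ln (d muN / d mu_^N) is integrable.
   For the upper bound, muN is compared with the product measure mu_^N, under
   which the particles are independent: smoothness of l bounds the excess risk
   by L / 2 times the variance of an average of N independent variables. *)

From HB Require Import structures.
Require Import Defs.
From mathcomp Require Import all_boot all_order all_algebra.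
From mathcomp Require Import all_classical all_reals all_analysis.
From mathcomp Require Import measurable_realfun ring lra.

Set Implicit Arguments.
Unset Strict Implicit.
Unset Printing Implicit Defensive.

Import Order.TTheory GRing.Theory Num.Theory.
Import numFieldNormedType.Exports.

Local Open Scope classical_set_scope.
Local Open Scope ring_scope.

(** Mean risk and entropy of [muN] are controlled only through their sum: the pointwise minorant of
    F contains the possibly unbounded [ln (p x)], so it does not bound the mean risk by itself.
    Adding the log-density of [muN] with respect to Lebesgue measure turns this term into the
    log-density with respect to the product measure. This cancellation is why a relative entropy
    appears on the left, and it leaves as only unbounded term one whose mean cannot be -oo. Each
    summand is then minorized by subtracting from the inequality the positive part of the other.
    Definedness conditions matter because a sum or integral of the form oo - oo takes the value -oo
    and would pass for one bounded above. In the upper bound the entropies cancel, entropy being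
    additive on powers. The constant comes from the quadratic term alone: L / 2, times N^-2, times
    N, times a total variance at most [rho ^+ 2]; the linear term has mean zero. *)

Section density.
Context d (T : measurableType d) (R : realType).
Local Open Scope ereal_scope.
Local Open Scope charge_scope.

(** Real valued and nonnegative at every point, so that [ln (p x)] makes sense pointwise; the
    Radon-Nikodym derivative is extended-real valued and determined only up to null sets. *)
Definition has_density (nu : {measure set T -> \bar R})
    (mu : set T -> \bar R) (p : T -> R) : Prop :=
  [/\ measurable_fun setT p, forall x, (0 <= p x)%R &
      forall A, measurable A -> mu A = \int[nu]_(x in A) (p x)%:E].

Lemma has_density_dominates (nu mu : {measure set T -> \bar R}) p :
  has_density nu mu p -> mu `<< nu.
Proof.
move=> [mp p0 muE]; apply/null_content_dominatesP => A mA nuA.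
rewrite muE// null_set_integral//.
by apply/measurable_EFinP; exact: measurable_funTS.
Qed.

Section finite.
Variables (nu : {sigma_finite_measure set T -> \bar R}).
Variables (mu : {finite_measure set T -> \bar R}) (p : T -> R).
Hypothesis pmu : has_density nu mu p.

Let numu := has_density_dominates pmu.

(** Both functions have the same integral, the value of [mu], over every measurable set. *)
Lemma has_density_Radon_Nikodym :
  ae_eq nu setT ('d (charge_of_finite_measure mu) '/d nu) (EFin \o p).
Proof.
case: (pmu) => mp p0 muE; apply: integral_ae_eq => //.
- exact: Radon_Nikodym_integrable.
- exact/measurable_EFinP.
- by move=> A _ mA; rewrite -Radon_Nikodym_integral//; exact: muE.
Qed.

Lemma integral_has_density (f : T -> \bar R) A : (forall x, 0 <= f x) ->
    measurable A -> measurable_fun A f ->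
  \int[mu]_(x in A) f x = \int[nu]_(x in A) (f x * (p x)%:E).
Proof.
move=> f0 mA mf.
rewrite -(Radon_Nikodym_SigmaFinite.change_of_variables numu)//.
case: (pmu) => mp p0 muE.
have mpE : measurable_fun A (EFin \o p).
  by apply/measurable_EFinP; exact: measurable_funTS.
have mrE : measurable_fun A (Radon_Nikodym_SigmaFinite.f mu nu).
  apply: measurable_funTS.
  exact: measurable_int (Radon_Nikodym_SigmaFinite.f_integrable _).
apply: ae_eq_integral => //; [exact: emeasurable_funM..|].
apply: ae_eqe_mul2l.
apply: ae_eq_trans (ae_eq_Radon_Nikodym_SigmaFinite numu mA) _.
exact: ae_eq_subset (@subsetT _ A) has_density_Radon_Nikodym.
Qed.

End finite.

(** The mass of the zero set of [p] is the integral of [p] over it. Logarithms of products of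
    densities split almost surely thanks to this. *)
Lemma has_density_ae_gt0 (nu mu : {measure set T -> \bar R}) p :
  has_density nu mu p -> {ae mu, forall x, (0 < p x)%R}.
Proof.
move=> [mp p0 muE]; have m0 : measurable [set x | p x = 0%R].
  rewrite -[X in measurable X]setTI.
  exact: (mp measurableT [set 0%R] (measurable_set1 _)).
exists [set x | p x = 0%R]; split => //.
  rewrite muE// integral0_eq// => x /= ->//.
move=> x /= /negP; rewrite -leNgt => px0.
by apply/eqP; rewrite eq_le px0 p0.
Qed.

(** The derivative and [p] agree off a [nu]-null set, which is also [mu]-null by domination. *)
Lemma log_density_has_density (nu : {sigma_finite_measure set T -> \bar R})
    (mu : probability T R) p : has_density nu mu p ->
  {ae mu, forall x, log_density nu mu x = (ln (p x))%:E}.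
Proof.
move=> pmu.
have [A [mA A0 sA]] := has_density_Radon_Nikodym pmu.
have /null_content_dominatesP := has_density_dominates pmu.
move=> /(_ A mA A0) muA0; exists A; split => // x /=; apply: contra_notP.
move=> nAx; rewrite /log_density.
by move/contrapT: (contra_not (@sA x) nAx) => ->.
Qed.

Lemma measurable_log_density (nu : {sigma_finite_measure set T -> \bar R})
    (mu : probability T R) : mu `<< nu ->
  measurable_fun setT (log_density nu mu).
Proof.
move=> munu; apply/measurable_EFinP; apply: measurableT_comp => //.
apply: measurableT_comp => //.
Qed.

Lemma has_density_exists (nu : {sigma_finite_measure set T -> \bar R})
    (mu : {finite_measure set T -> \bar R}) : mu `<< nu ->
  exists p, has_density nu mu p.
Proof.
move=> munu; exists (fine \o Radon_Nikodym_SigmaFinite.f mu nu); split.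
- apply: measurableT_comp => //.
  exact: measurable_int (Radon_Nikodym_SigmaFinite.f_integrable _).
- by move=> x; apply: fine_ge0; exact: Radon_Nikodym_SigmaFinite.f_ge0.
- move=> A mA; rewrite (Radon_Nikodym_SigmaFinite.f_integral munu)//.
  apply: eq_integral => x _ /=; rewrite fineK//.
  exact: Radon_Nikodym_SigmaFinite.f_fin_num.
Qed.

Lemma entropy_has_density (nu : {sigma_finite_measure set T -> \bar R})
    (mu : probability T R) p : has_density nu mu p ->
  entropy nu mu = \int[mu]_x (ln (p x))%:E.
Proof.
move=> pmu; have munu := has_density_dominates pmu.
rewrite /entropy asboolT//; apply: ae_eq_integral => //.
- exact: measurable_log_density.
- by apply/measurable_EFinP; apply: measurableT_comp => //; case: pmu.
- have [A [mA A0 sA]] := log_density_has_density pmu.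
  by exists A; split => // x /= h; apply: sA => /= h'; apply: h.
Qed.

(* [- t ln t <= 1], so the negative part of the relative entropy is finite. *)
Lemma integral_neg_ln_density (nu mu : probability T R) (p : T -> R) :
  has_density nu mu p -> \int[mu]_x (Num.max 0 (- ln (p x)))%:E <= 1.
Proof.
move=> pmu; have [mp p0 muE] := pmu.
have ml : measurable_fun setT (fun x => Num.max 0 (- ln (p x)))%R.
  apply: measurable_maxr => //; apply: measurableT_comp => //.
  exact: measurableT_comp.
rewrite (integral_has_density pmu)//; last 2 first.
- by move=> x; rewrite lee_fin le_max lexx.
- exact/measurable_EFinP.
have : \int[nu]_x 1 = 1.
  by rewrite integral_cst// mul1e; exact: probability_setT.
move=> <-; apply: ge0_le_integral => //.
- by move=> x _; rewrite lee_fin mulr_ge0// le_max lexx.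
- by apply/measurable_EFinP; exact: measurable_funM.
move=> x _; rewrite lee_fin.
have := p0 x; rewrite le_eqVlt => /predU1P[<-|px]; first by rewrite mulr0.
rewrite maxr_pMl// mul0r ge_max ler01/= -lnV ?posrE//.
by rewrite -ler_pdivlMr// mul1r ltW// ln_sublinear// invr_gt0.
Qed.

End density.

Section measure_probability.
Context d (T : measurableType d) (R : realType).
Variable mu : {measure set T -> \bar R}.
Hypothesis mu1 : mu setT = 1%E.

Definition as_probability of mu setT = 1%E : set T -> \bar R := mu.

Let P := as_probability mu1.

Let P0 : P set0 = 0%E. Proof. exact: measure0. Qed.

Let P_ge0 A : (0 <= P A)%E. Proof. exact: measure_ge0. Qed.

Let P_sigma_additive : semi_sigma_additive P.
Proof. exact: measure_semi_sigma_additive. Qed.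

HB.instance Definition _ := isMeasure.Build _ _ _ P P0 P_ge0 P_sigma_additive.

HB.instance Definition _ := Measure_isProbability.Build _ _ _ P mu1.

(** Powers and empirical measures have mass 1 without carrying a [probability] structure; this
    supplies a copy that does. The copy agrees as a set function only, so integrals are transported
    by [eq_measure_integral]. *)
Lemma measure_probability : exists Q : probability T R, forall A, Q A = mu A.
Proof. by exists P. Qed.

End measure_probability.

(** * Integrals of real-valued functions *)

Section real_integrals.
Context d (T : measurableType d) (R : realType).
Variable mu : {measure set T -> \bar R}.
Implicit Types f g : T -> R.
Local Open Scope ereal_scope.

Lemma integrable_addr f g : mu.-integrable setT (EFin \o f) ->
    mu.-integrable setT (EFin \o g) ->
  mu.-integrable setT (EFin \o (fun x => f x + g x)%R).
Proof. by move=> fi gi; exact: (integrableD measurableT fi gi). Qed.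

Lemma integrable_mulr k f : mu.-integrable setT (EFin \o f) ->
  mu.-integrable setT (EFin \o (fun x => k * f x)%R).
Proof. by move=> fi; exact: (integrableZl measurableT k fi). Qed.

Lemma integral_addr f g : mu.-integrable setT (EFin \o f) ->
    mu.-integrable setT (EFin \o g) ->
  \int[mu]_x (f x + g x)%:E = \int[mu]_x (f x)%:E + \int[mu]_x (g x)%:E.
Proof. by move=> fi gi; exact: (integralD measurableT fi gi). Qed.

Lemma integral_mulr k f : mu.-integrable setT (EFin \o f) ->
  \int[mu]_x (k * f x)%:E = k%:E * \int[mu]_x (f x)%:E.
Proof. by move=> fi; exact: (integralZl measurableT fi k). Qed.

Lemma integral_cst_probability k : mu setT = 1 -> \int[mu]_x k%:E = k%:E.
Proof.
move=> mu1; rewrite -[RHS]mule1 -mu1.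
exact: (integral_cst mu measurableT k%:E).
Qed.

Lemma integrable_cst_probability k : mu setT = 1 ->
  mu.-integrable setT (EFin \o cst k).
Proof.
move=> mu1; apply/integrableP; split; first by apply/measurable_EFinP.
by rewrite (integral_cst_probability `|k|%R mu1) ltry.
Qed.

Lemma integrable_mulrK k f : (0 < k)%R ->
    mu.-integrable setT (EFin \o (fun x => k * f x)%R) ->
  mu.-integrable setT (EFin \o f).
Proof.
move=> k0 /(integrable_mulr k^-1%R); apply: eq_integrable => // x _ /=.
by rewrite mulKf// gt_eqF.
Qed.

Lemma eq_measure_integrable (nu : {measure set T -> \bar R}) f :
    (forall A, nu A = mu A) -> mu.-integrable setT (EFin \o f) ->
  nu.-integrable setT (EFin \o f).
Proof.
move=> numu /integrableP[mf fi]; apply/integrableP; split => //.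
apply: le_lt_trans fi; rewrite le_eqVlt; apply/orP; left; apply/eqP.
by apply: eq_measure_integral => A _ _; exact: numu.
Qed.

Lemma integrable_ae_le f g : measurable_fun setT f ->
    mu.-integrable setT (EFin \o g) ->
    {ae mu, forall x, (`|f x| <= g x)%R} ->
  mu.-integrable setT (EFin \o f).
Proof.
move=> mf ig fg; apply/integrableP; split; first exact/measurable_EFinP.
have /integrableP[mg] := ig; apply: le_lt_trans.
apply: ae_ge0_le_integral => //.
- by apply: measurableT_comp => //; exact/measurable_EFinP.
- exact: measurableT_comp.
- apply: filterS fg => x fgx _ /=.
  by rewrite lee_fin (le_trans fgx)// ler_norm.
Qed.

(** Almost everywhere [g x - f x] is its own absolute value, so its integral is that of a
    nonnegative function. *)
Lemma ae_le_integral f g : mu.-integrable setT (EFin \o f) ->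
    mu.-integrable setT (EFin \o g) -> {ae mu, forall x, (f x <= g x)%R} ->
  \int[mu]_x (f x)%:E <= \int[mu]_x (g x)%:E.
Proof.
move=> fi gi fg; have gBf := integrableB measurableT gi fi.
rewrite -sube_ge0; last first.
  by rewrite [X in X || _](integrable_fin_num measurableT fi).
rewrite -integralB//.
rewrite (ae_eq_integral (fun x => `|(g x - f x)%R|%:E))//.
- by apply: integral_ge0 => x _; rewrite lee_fin.
- exact: measurable_int gBf.
- apply/measurable_EFinP; apply: measurableT_comp => //.
  exact/measurable_EFinP/(measurable_int _ gBf).
- by apply: filterS fg => x fgx _ /=; rewrite ger0_norm ?subr_ge0.
Qed.

Lemma integrable_maxr0 f : measurable_fun setT f ->
    \int[mu]_x (Num.max (f x) 0)%:E < +oo ->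
  mu.-integrable setT (fun x => (Num.max (f x) 0)%:E).
Proof.
move=> mf fi; apply/integrableP; split.
  by apply/measurable_EFinP; exact: measurable_maxr.
under eq_integral do rewrite gee0_abs ?lee_fin ?le_max ?lexx ?orbT//.
exact: fi.
Qed.

Lemma integrable_sumr (I : Type) (s : seq I) (f : I -> T -> R) :
    (forall i, mu.-integrable setT (EFin \o f i)) ->
  mu.-integrable setT (EFin \o (fun t => \sum_(i <- s) f i t)%R).
Proof.
move=> fi; apply: (eq_integrable measurableT
  (fun t => \sum_(i <- s) (f i t)%:E)).
  by move=> t _; rewrite /= sumEFin.
by apply: integrable_sum => // i _; exact: fi.
Qed.

Lemma integral_sumr (I : Type) (s : seq I) (f : I -> T -> R) :
    (forall i, mu.-integrable setT (EFin \o f i)) ->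
  \int[mu]_t (\sum_(i <- s) f i t)%:E = \sum_(i <- s) \int[mu]_t (f i t)%:E.
Proof.
move=> fi; under eq_integral do rewrite -sumEFin.
by rewrite integral_sum// => i; exact: fi.
Qed.

End real_integrals.

(** * Powers of a probability: marginals, densities, second moments of sums *)

Section power_measure_theory.
Context d (T : measurableType d) (R : realType).
Local Open Scope ereal_scope.

(** The power is by construction an image of a product measure under [tuple_cons]: change variables,
    then apply Tonelli. *)
Lemma integral_power_measureS (mu : {sigma_finite_measure set T -> \bar R}) n
    (f : n.+1.-tuple T -> \bar R) :
    measurable_fun setT f -> (forall t, 0 <= f t) ->
  \int[power_measure mu n.+1]_t f t =
  \int[mu]_x \int[power_measure mu n]_t f (tuple_cons (x, t)).
Proof.
move=> mf f0; have mcons := @measurable_tuple_cons d T n.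
transitivity (\int[(mu \x power_measure mu n)%E]_z f (tuple_cons z)).
  have := @ge0_integral_pushforward _ _ _ _ R _ mcons
    (mu \x power_measure mu n)%E _ _ measurableT mf (fun t _ => f0 t).
  rewrite preimage_setT => <-.
  exact: eq_measure_integral.
by rewrite fubini_tonelli1//; exact: measurableT_comp.
Qed.

Lemma measurable_integral_tuple_cons
    (mu : {sigma_finite_measure set T -> \bar R}) n
    (f : n.+1.-tuple T -> \bar R) :
    measurable_fun setT f -> (forall t, 0 <= f t) ->
  measurable_fun setT
    (fun x => \int[power_measure mu n]_t f (tuple_cons (x, t))).
Proof.
move=> mf f0.
apply: (@measurable_fun_fubini_tonelli_F _ _ _ _ _ (power_measure mu n)
  (f \o @tuple_cons d T n)) => //.
- by apply: measurableT_comp => //; exact: measurable_tuple_cons.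
- by move=> x; exact: f0.
Qed.

Lemma power_measureS_setX (mu : {sigma_finite_measure set T -> \bar R}) n
    (A : set T) (B : set (n.-tuple T)) : measurable A -> measurable B ->
  power_measure mu n.+1 [set t | A (tnth t ord0) /\ B [tuple of behead t]] =
  mu A * power_measure mu n B.
Proof.
move=> mA mB; rewrite -product_measure1E//=; congr (_ _).
by apply/seteqP; split => -[x t] /= []; rewrite /tuple_cons/= => Ax Bt;
  split => //; move: Bt; congr B; exact/val_inj.
Qed.

Lemma power_measure_setT (mu : probability T R) n :
  power_measure mu n setT = 1.
Proof.
elim: n => [|n ih]; first by rewrite /= diracT.
rewrite (_ : setT = [set t : n.+1.-tuple T |
    [set: T] (tnth t ord0) /\ [set: n.-tuple T] [tuple of behead t]]).
  by rewrite power_measureS_setX// ih mule1; exact: probability_setT.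
by apply/seteqP; split.
Qed.

(** Coordinate [i] is either the head or a coordinate of the tail, so the set is a rectangle one
    side of which is the whole space, of mass 1. *)
Lemma power_measure_tnth (mu : probability T R) n (i : 'I_n) (A : set T) :
  measurable A -> power_measure mu n [set t | A (tnth t i)] = mu A.
Proof.
move=> mA; elim: n i => [[]//|n ih] i.
case: (unliftP ord0 i) => [j ->|->]; last first.
- transitivity (mu A * power_measure mu n setT); last first.
    by rewrite power_measure_setT mule1.
  rewrite -power_measureS_setX//; congr (_ _).
  by apply/seteqP; split => t //= -[].
- transitivity (mu setT * power_measure mu n [set t | A (tnth t j)]).
    rewrite -power_measureS_setX//; last first.
      rewrite -[X in measurable X]setTI.
      exact: (@measurable_tnth _ T n j measurableT).
    have tj (t : n.+1.-tuple T) :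
        tnth [tuple of behead t] j = tnth t (lift ord0 j).
      rewrite tnth_behead; congr tnth; apply/val_inj.
      by rewrite /= inordK// ltnS ltn_ord.
    congr (_ _); apply/seteqP; split => t; rewrite /= -tj; first by [].
    by case.
  by rewrite ih probability_setT mul1e.
Qed.

Lemma ge0_integral_power_measure_tnth (mu : probability T R) n (i : 'I_n)
    (f : T -> \bar R) : measurable_fun setT f -> (forall x, 0 <= f x) ->
  \int[power_measure mu n]_t f (tnth t i) = \int[mu]_x f x.
Proof.
move=> mf f0; have := @ge0_integral_pushforward _ _ _ _ R _
  (@measurable_tnth _ T n i) (power_measure mu n) _ _ measurableT mf
  (fun t _ => f0 t).
rewrite preimage_setT => /esym ->.
apply: eq_measure_integral => [|mt A mA _]; first exact: measurable_tnth.
exact: (power_measure_tnth mu i mA).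
Qed.

Lemma integrable_power_measure_tnth (mu : probability T R) n (i : 'I_n)
    (f : T -> R) : mu.-integrable setT (EFin \o f) ->
  (power_measure mu n).-integrable setT (fun t => (f (tnth t i))%:E).
Proof.
move=> /integrableP[mf fi]; apply/integrableP; split.
  by apply: (measurableT_comp mf); exact: measurable_tnth.
rewrite (ge0_integral_power_measure_tnth mu i (f := fun x => `|(f x)%:E|))//.
exact: measurableT_comp.
Qed.

(** Positive and negative parts are transported separately, so the equality holds without
    integrability. *)
Lemma integral_power_measure_tnth (mu : probability T R) n (i : 'I_n)
    (f : T -> R) : measurable_fun setT f ->
  \int[power_measure mu n]_t (f (tnth t i))%:E = \int[mu]_x (f x)%:E.
Proof.
move=> /measurable_EFinP mf; rewrite integralE [RHS]integralE.
rewrite -[in RHS](ge0_integral_power_measure_tnth mu i)//; last first.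
  exact: measurable_funepos.
rewrite -[in RHS](ge0_integral_power_measure_tnth mu i)//; last first.
  exact: measurable_funeneg.
by congr (_ - _); apply: eq_integral => t _; rewrite ?(funeposE, funenegE).
Qed.

Lemma integrable_power_measure_sum (mu : probability T R) n (f : T -> R) :
  mu.-integrable setT (EFin \o f) ->
  (power_measure mu n).-integrable setT
    (fun t => (\sum_(i < n) f (tnth t i))%:E).
Proof.
move=> fi.
exact: (integrable_sumr _ (fun i => integrable_power_measure_tnth i fi)).
Qed.

Lemma integral_power_measure_sum (mu : probability T R) n (f : T -> R) :
  mu.-integrable setT (EFin \o f) ->
  \int[power_measure mu n]_t (\sum_(i < n) f (tnth t i))%:E =
  n%:R%:E * \int[mu]_x (f x)%:E.
Proof.
move=> fi.
rewrite (integral_sumr _ (fun i => integrable_power_measure_tnth i fi)).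
rewrite (eq_bigr (fun=> \int[mu]_x (f x)%:E)); last first.
  move=> i _; apply: integral_power_measure_tnth.
  exact/measurable_EFinP/(measurable_int _ fi).
rewrite -(fineK (integrable_fin_num measurableT fi)).
by rewrite sumEFin sumr_const card_ord -EFinM mulr_natl.
Qed.

(** Tonelli peels off the head; [pmu] changes the outer measure and the induction hypothesis the
    inner one, [p x] being a constant for the inner integral. *)
Lemma has_density_power_measure (mu : probability T R)
    (nu : {sigma_finite_measure set T -> \bar R}) p n : has_density nu mu p ->
  has_density (power_measure nu n) (power_measure mu n)
    (fun t => (\prod_(i < n) p (tnth t i))%R).
Proof.
move=> pmu; have [mp p0 muE] := pmu.
have mprod k : measurable_fun setT
    (fun t : k.-tuple T => (\prod_(i < k) p (tnth t i))%R).
  apply: measurable_prod => i _; apply: measurableT_comp => //.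
  exact: measurable_tnth.
elim: n => [|n [_ ih0 ihE]].
  split; [exact: mprod|by move=> t; rewrite big_ord0|].
  move=> A mA; under eq_integral do rewrite big_ord0.
  by rewrite integral_cst//= mul1e.
split; [exact: mprod|by move=> t; exact: prodr_ge0|move=> A mA].
have mA1 : measurable_fun setT (fun t => (\1_A t)%:E : \bar R).
  exact/measurable_EFinP.
transitivity (\int[power_measure mu n.+1]_t (\1_A t)%:E).
  by rewrite integral_indic// setIT.
rewrite integral_power_measureS//.
rewrite [RHS]integral_mkcond integral_power_measureS//; last 2 first.
- apply/(measurable_restrictT _ mA)/measurable_funTS/measurable_EFinP.
  exact: mprod.
- by move=> t; apply: erestrict_ge0 => {}t _; rewrite lee_fin prodr_ge0.
rewrite (integral_has_density pmu)//; last 2 first.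
- by move=> x; apply: integral_ge0 => t _; rewrite lee_fin.
- by apply: (measurable_integral_tuple_cons mu mA1) => t; rewrite lee_fin.
apply: eq_integral => x _.
(* [integral_has_density] asks for a finite measure, whereas the power carries only a sigma-finite
   structure. *)
have [Q QE] := measure_probability (power_measure_setT mu n).
have QP : has_density (power_measure nu n) Q
    (fun t => (\prod_(i < n) p (tnth t i))%R).
  by split; [exact: mprod|exact: ih0|move=> B mB; rewrite -ihE//; exact: QE].
rewrite (eq_measure_integral Q); last by move=> B _ _; exact/esym/QE.
rewrite (integral_has_density QP)//; last first.
  apply: measurableT_comp mA1 _ => /=.
  apply: measurableT_comp; first exact: measurable_tuple_cons.
  exact: measurable_pair1.
rewrite -ge0_integralZr//; last 3 first.
- apply: emeasurable_funM; last by apply/measurable_EFinP; exact: mprod.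
  apply: measurableT_comp mA1 _ => /=.
  apply: measurableT_comp; first exact: measurable_tuple_cons.
  exact: measurable_pair1.
- by move=> t _; rewrite -EFinM lee_fin mulr_ge0.
- by rewrite lee_fin.
apply: eq_integral => t _; rewrite /= patchE indicE.
case: ifPn => _; last by rewrite !mul0e.
rewrite mul1e -EFinM big_ord_recl mulrC; congr (_ * _)%:E.
by apply: eq_bigr => i _; congr (p _); rewrite /tuple_cons/= tnthS.
Qed.

(* Independence, one coordinate at a time: the cross term in
   [(f x + \sum_i f (t_i)) ^+ 2] vanishes when integrating over [t]. *)
Lemma integral_power_measure_sum_sqr (mu : probability T R) n (f : T -> R) :
  mu.-integrable setT (EFin \o f) -> \int[mu]_x (f x)%:E = 0 ->
  mu.-integrable setT (fun x => (f x ^+ 2)%:E) ->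
  (power_measure mu n).-integrable setT
    (fun t => ((\sum_(i < n) f (tnth t i)) ^+ 2)%:E) /\
  \int[power_measure mu n]_t ((\sum_(i < n) f (tnth t i)) ^+ 2)%:E =
  n%:R%:E * \int[mu]_x (f x ^+ 2)%:E.
Proof.
move=> fi f0 f2i; have mf : measurable_fun setT f.
  exact/measurable_EFinP/(measurable_int _ fi).
have msum k : measurable_fun setT
    (fun t : k.-tuple T => (\sum_(i < k) f (tnth t i))%R).
  by apply: measurable_sum => i; apply: measurableT_comp => //;
    exact: measurable_tnth.
have m2 k : measurable_fun setT
    (fun t : k.-tuple T => ((\sum_(i < k) f (tnth t i)) ^+ 2)%:E).
  by apply/measurable_EFinP; apply: measurable_funX; exact: msum.
(* The integrand is nonnegative, so the finite value of its integral gives integrability: at each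
   stage only the equation has to be proved. *)
have int_lty k : \int[power_measure mu k]_t
      ((\sum_(i < k) f (tnth t i)) ^+ 2)%:E =
    k%:R%:E * \int[mu]_x (f x ^+ 2)%:E ->
  (power_measure mu k).-integrable setT
    (fun t => ((\sum_(i < k) f (tnth t i)) ^+ 2)%:E).
  move=> intE; apply/integrableP; split; first exact: m2.
  under eq_integral do rewrite gee0_abs ?lee_fin ?sqr_ge0//.
  rewrite intE -(fineK (integrable_fin_num measurableT f2i)).
  by rewrite -EFinM ltry.
elim: n => [|n [ihi ihE]].
  have E0 : \int[power_measure mu 0]_t
      ((\sum_(i < 0) f (tnth t i)) ^+ 2)%:E = 0.
    by under eq_integral do rewrite big_ord0 expr0n/=; rewrite integral0.
  by split; [apply: int_lty|]; rewrite E0 mul0e.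
suff intE : \int[power_measure mu n.+1]_t
      ((\sum_(i < n.+1) f (tnth t i)) ^+ 2)%:E =
    n.+1%:R%:E * \int[mu]_x (f x ^+ 2)%:E by split => //; exact: int_lty.
rewrite integral_power_measureS//; last by move=> t; rewrite lee_fin sqr_ge0.
set v := \int[mu]_x (f x ^+ 2)%:E in ihE *.
have vfin : v \is a fin_num by exact: integrable_fin_num.
have pT : power_measure mu n setT = 1 by exact: power_measure_setT.
have cst_int c := integrable_cst_probability c pT.
have inner x : \int[power_measure mu n]_t
      ((\sum_(i < n.+1) f (tnth (tuple_cons (x, t)) i)) ^+ 2)%:E =
    (f x ^+ 2)%:E + n%:R%:E * v.
  transitivity (\int[power_measure mu n]_t ((f x ^+ 2)%:E +
      ((f x *+ 2)%:E * (\sum_(i < n) f (tnth t i))%:E +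
       ((\sum_(i < n) f (tnth t i)) ^+ 2)%:E))).
    apply: eq_integral => t _; rewrite big_ord_recl /tuple_cons/=.
    under eq_bigr do rewrite tnthS.
    by rewrite sqrrD -addrA -mulrnAl EFinD EFinD EFinM.
  have si := integrable_power_measure_sum n fi.
  rewrite integralD//; [|exact: (cst_int (f x ^+ 2)%R)|]; last first.
    by apply: integrableD => //; exact: integrableZl.
  rewrite integral_cst// [X in _ * X + _]pT mule1; congr (_ + _).
  rewrite integralD//; last exact: integrableZl.
  by rewrite integralZl// integral_power_measure_sum// f0 mule0 mule0 add0e.
under eq_integral do rewrite inner.
rewrite integralD//; last first.
  rewrite -(fineK vfin) -EFinM.
  exact: (finite_measure_integrable_cst mu (n%:R * fine v)).
rewrite integral_cst// [X in _ + _ * X](probability_setT mu) mule1 -/v.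
by rewrite -(fineK vfin) -!EFinM -EFinD -[n.+1]add1n natrD mulrDl mul1r.
Qed.

End power_measure_theory.

(** * Finiteness of energy and entropies, and the relative entropy inequality *)

Section relative_entropy.
Context d (T : measurableType d) (R : realType).
Local Open Scope ereal_scope.

(** If the positive part had infinite integral, definedness would make the negative part finite and
    the whole integral +oo. *)
Lemma integral_defined_lty (mu : probability T R) (f : T -> \bar R) :
    integral_defined mu f -> \int[mu]_x f x < +oo ->
  \int[mu]_x f^\+ x < +oo.
Proof.
rewrite /integral_defined (integralE _ _ f).
have : 0 <= \int[mu]_x f^\+ x by apply: integral_ge0 => x _; exact: funepos_ge0.
have : 0 <= \int[mu]_x f^\- x by apply: integral_ge0 => x _; exact: funeneg_ge0.
case: (\int[mu]_x f^\+ x) => [r||] //; first by rewrite ltry.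
by case: (\int[mu]_x f^\- x).
Qed.

Lemma has_density_trans (nu Q : {sigma_finite_measure set T -> \bar R})
    (mu : {measure set T -> \bar R}) (p r : T -> R) : Q setT = 1 ->
    has_density nu Q p -> has_density Q mu r ->
  has_density nu mu (fun x => (r x * p x)%R).
Proof.
move=> Q1 pQ [mr r0 muE]; have [mp p0 QE] := pQ.
have [Q' Q'E] := measure_probability Q1.
split; [exact: measurable_funM|by move=> x; rewrite mulr_ge0|move=> A mA].
rewrite muE//; transitivity (\int[Q']_(x in A) (r x)%:E).
  by apply: eq_measure_integral => B _ _; exact/esym/Q'E.
have pQ' : has_density nu Q' p by split=> // B mB; rewrite -QE.
rewrite (integral_has_density pQ')//.
by apply/measurable_EFinP; exact: measurable_funTS.
Qed.

(* All the terms are finite because [ln r] is bounded below in mean, [r] being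
   the density of [mu] with respect to the probability [Q]. *)
Lemma relative_entropy_le (nu Q : {sigma_finite_measure set T -> \bar R})
    (mu : probability T R) (p G : T -> R) (a lam c : R) :
    (0 < a)%R -> (0 < lam)%R -> Q setT = 1 -> has_density nu Q p ->
    mu `<< Q -> measurable_fun setT G ->
    {ae mu, forall x, (c - lam * ln (p x) <= a * G x)%R} ->
    integral_defined mu (EFin \o G) -> entropy_defined nu mu ->
    a%:E * \int[mu]_x (G x)%:E +? lam%:E * entropy nu mu ->
    a%:E * \int[mu]_x (G x)%:E + lam%:E * entropy nu mu < +oo ->
  exists K E H : R, [/\ KL mu Q = K%:E, \int[mu]_x (G x)%:E = E%:E,
    entropy nu mu = H%:E & (lam * K <= a * E + lam * H - c)%R].
Proof.
move=> a0 lam0 Q1 pQ muQ mG Gp Gdef Hdef sumdef sum_lty.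
(* [r] and [q] are the densities of [mu] with respect to [Q] and [nu]: [KL mu Q] is the mean of
   [ln (r x)] and [entropy nu mu] that of [ln (q x)]. *)
have [r rmu] := has_density_exists muQ.
have qmu := has_density_trans Q1 pQ rmu.
set q := fun x => (r x * p x)%R in qmu.
have mr : measurable_fun setT r by case: rmu.
have mq : measurable_fun setT q by case: qmu.
have mlr : measurable_fun setT (fun x => ln (r x)) by exact: measurableT_comp.
have mlq : measurable_fun setT (fun x => ln (q x)) by exact: measurableT_comp.
have munu := has_density_dominates qmu.
(* Were one summand +oo, definedness would keep the other away from -oo and the total would be
   +oo. *)
have [E_lty H_lty] : \int[mu]_x (G x)%:E < +oo /\ entropy nu mu < +oo.
  move: sumdef sum_lty; move: (\int[mu]_x _) (entropy nu mu) => u v.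
  by case: u => [u||]; case: v => [v||]//=;
    rewrite ?(gt0_muley, gt0_muleNy) ?lte_fin// => _ _; split; rewrite ?ltry.
have Gpos : mu.-integrable setT (fun x => (Num.max (G x) 0)%:E).
  apply: integrable_maxr0 => //.
  apply: le_lt_trans (integral_defined_lty Gdef E_lty).
  by under eq_integral do rewrite EFin_max -/((EFin \o G) _) -funeposE.
have qpos : mu.-integrable setT (fun x => (Num.max (ln (q x)) 0)%:E).
  apply: integrable_maxr0 => //.
  have H_lty' : \int[mu]_x log_density nu mu x < +oo.
    by move: H_lty; rewrite /entropy asboolT.
  have := integral_defined_lty (Hdef munu) H_lty'; apply: le_lt_trans.
  have ml := measurable_log_density munu.
  rewrite (ae_eq_integral (log_density nu mu)^\+)//.
  - by apply/measurable_EFinP; exact: measurable_maxr.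
  - exact: measurable_funepos.
  - apply: filterS (log_density_has_density qmu) => x lx _.
    by rewrite funeposE lx EFin_max.
have rneg : mu.-integrable setT (fun x => (Num.max (- ln (r x)) 0)%:E).
  apply: integrable_maxr0; first exact: measurableT_comp.
  have [Q' Q'E] := measure_probability Q1.
  have rmu' : has_density Q' mu r.
    case: rmu => _ r0 muE; split => // A mA; rewrite muE//.
    by apply: eq_measure_integral => B _ _; exact/esym/Q'E.
  apply: le_lt_trans (ltry 1).
  by under eq_integral do rewrite maxC; exact: integral_neg_ln_density rmu'.
have lnq : {ae mu, forall x, (ln (q x) = ln (r x) + ln (p x))%R}.
  apply: filterS2 (has_density_ae_gt0 qmu) (has_density_ae_gt0 rmu).
  move=> x qx rx; rewrite /q lnM// posrE.
  by rewrite -(pmulr_rgt0 _ rx).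
have lower : {ae mu, forall x,
    (c + lam * ln (r x) <= a * G x + lam * ln (q x))%R}.
  by apply: filterS2 Gp lnq => x + ->; lra.
have cst_int (k : R) : mu.-integrable setT (EFin \o cst k).
  exact: integrable_cst_probability (probability_setT mu).
pose nr x : R := Num.max (- ln (r x))%R 0%R.
have {}rneg : mu.-integrable setT (EFin \o nr) by exact: rneg.
pose pq x : R := Num.max (ln (q x))%R 0%R.
have {}qpos : mu.-integrable setT (EFin \o pq) by exact: qpos.
pose pG x : R := Num.max (G x)%R 0%R.
have {}Gpos : mu.-integrable setT (EFin \o pG) by exact: Gpos.
have nrE x : (0 <= lam * nr x)%R /\ (- (lam * nr x) <= lam * ln (r x))%R.
  rewrite pmulr_rge0// -mulrN ler_pM2l// lerNl.
  by rewrite /nr !le_max !lexx orbT.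
have pqE x : (0 <= lam * pq x)%R /\ (lam * ln (q x) <= lam * pq x)%R.
  by rewrite pmulr_rge0// ler_pM2l// /pq !le_max !lexx orbT.
have pGE x : (0 <= a * pG x)%R /\ (a * G x <= a * pG x)%R.
  by rewrite pmulr_rge0// ler_pM2l// /pG !le_max !lexx orbT.
(* One dominating function serves both [a * G x] and [lam * ln (q x)]. Each is at most its positive
   part; from below, [lower] applies after subtracting the positive part of the other and replacing
   [ln (r x)] by [- nr x]. *)
have bound_i : mu.-integrable setT (EFin \o (fun x =>
    `|c| + (lam * nr x + (lam * pq x + a * pG x)))%R).
  exact: (integrable_addr (cst_int _) (integrable_addr (integrable_mulr _ rneg)
    (integrable_addr (integrable_mulr _ qpos) (integrable_mulr _ Gpos)))).
have le_c : (c <= `|c|)%R /\ (- c <= `|c|)%R.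
  by rewrite ler_norm -normrN ler_norm.
have aGi : mu.-integrable setT (EFin \o (fun x => a * G x)%R).
  apply: integrable_ae_le bound_i _; first exact: measurable_funM.
  apply: filterS lower => x h; rewrite ler_norml.
  move: (nrE x) (pqE x) (pGE x) le_c => [? ?] [? ?] [? ?] [? ?].
  by apply/andP; split; lra.
have lqi : mu.-integrable setT (EFin \o (fun x => lam * ln (q x))%R).
  apply: integrable_ae_le bound_i _; first exact: measurable_funM.
  apply: filterS lower => x h; rewrite ler_norml.
  move: (nrE x) (pqE x) (pGE x) le_c => [? ?] [? ?] [? ?] [? ?].
  by apply/andP; split; lra.
have sum_i := integrable_addr aGi lqi.
(* Only now is [ln (r x)] bounded above, since [lower] puts it below a sum just shown to be
   integrable. *)
have lri : mu.-integrable setT (EFin \o (fun x => lam * ln (r x))%R).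
  have b_i := integrable_addr (integrable_addr (cst_int `|c|%R)
    (integrable_norm sum_i)) (integrable_mulr lam rneg).
  apply: integrable_ae_le b_i _; first exact: measurable_funM.
  apply: filterS lower => x h; rewrite ler_norml /=.
  have := ler_norm (a * G x + lam * ln (q x))%R.
  have := normr_ge0 (a * G x + lam * ln (q x))%R.
  move: (nrE x) le_c => [? ?] [? ?] ? ?.
  by apply/andP; split; lra.
have Gi := integrable_mulrK a0 aGi.
have lqi1 := integrable_mulrK lam0 lqi.
have lri1 := integrable_mulrK lam0 lri.
have KE : KL mu Q = \int[mu]_x (ln (r x))%:E by exact: entropy_has_density.
have HE : entropy nu mu = \int[mu]_x (ln (q x))%:E.
  exact: entropy_has_density.
exists (fine (\int[mu]_x (ln (r x))%:E)), (fine (\int[mu]_x (G x)%:E)),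
  (fine (\int[mu]_x (ln (q x))%:E)).
have fK := fineK (integrable_fin_num measurableT lri1).
have fE := fineK (integrable_fin_num measurableT Gi).
have fH := fineK (integrable_fin_num measurableT lqi1).
rewrite KE HE; split => //.
rewrite -lee_fin EFinB EFinD !EFinM [X in lam%:E * X]fK [X in a%:E * X]fE.
rewrite [X in _ + lam%:E * X - _]fH.
have := ae_le_integral (integrable_addr (cst_int c) lri) sum_i lower.
rewrite (integral_addr (cst_int c) lri) (integral_addr aGi lqi).
rewrite (integral_cst_probability c (probability_setT mu)).
rewrite (integral_mulr a Gi) (integral_mulr lam lqi1) (integral_mulr lam lri1).
by rewrite leeBrDl// addeC.
Qed.

End relative_entropy.

(** * Borel measurability and Euclidean norms of row vectors *)

Section borel_rV.
Context {R : realType}.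

Lemma measurable_fun_row d (T : measurableType d) n (f : T -> 'rV[R]_n) :
  (forall k, measurable_fun setT (fun t => f t ord0 k)) ->
  measurable_fun setT f.
Proof.
move=> mf; rewrite (_ : f = @row_of_tuple R n \o (@tuple_of_row R n \o f)).
  apply: measurableT_comp; first exact: measurable_row_of_tuple.
  apply/measurable_fun_tnthP => k.
  apply: (eq_measurable_fun (fun t => f t ord0 k)) => [t _|]; last exact: mf.
  by rewrite /= tnth_mktuple.
apply/funext => t /=; apply/rowP => k.
by rewrite [row_of_tuple _ _ _]mxE tnth_mktuple.
Qed.

Lemma continuous_measurable_mx m n (g : 'M[R]_(m, n) -> R) :
  continuous g -> measurable_fun setT g.
Proof.
move=> cg; apply: (measurability _ (RGenOpens.measurableE R)).
move=> _ [_ [a [b ->] <-]]; rewrite setTI; apply: open_measurable_mx.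
by apply: open_comp => [x _|]; [exact: cg|exact: interval_open].
Qed.

Lemma norm2_sqr m n (A : 'M[R]_(m, n)) :
  norm2 A ^+ 2 = \sum_i \sum_j A i j ^+ 2.
Proof.
rewrite sqr_sqrtr// sumr_ge0// => i _; rewrite sumr_ge0// => j _.
exact: sqr_ge0.
Qed.

Lemma norm2_sqr_rV n (v : 'rV[R]_n) : norm2 v ^+ 2 = \sum_j v ord0 j ^+ 2.
Proof. by rewrite norm2_sqr big_ord1. Qed.

Lemma dot_sum n (u v : 'rV[R]_n) : dot u v = \sum_j u ord0 j * v ord0 j.
Proof. by rewrite /dot mxE; apply: eq_bigr => j _; rewrite mxE. Qed.

Lemma measurable_norm2_sqr n :
  measurable_fun setT (fun v : 'rV[R]_n => norm2 v ^+ 2).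
Proof.
under eq_fun do rewrite norm2_sqr_rV.
apply: measurable_sum => j; apply: measurable_funX.
by apply: continuous_measurable_mx => v; exact: coord_continuous.
Qed.

End borel_rV.

(** * Integrals against empirical measures and mixtures *)

Section empirical_measure.
Context {R : realType} {d : nat}.
Local Open Scope ereal_scope.

Lemma ge0_integral_empirical N (x : N.-tuple 'rV[R]_d)
    (f : 'rV[R]_d -> \bar R) : measurable_fun setT f -> (forall v, 0 <= f v) ->
  \int[empirical x]_v f v = N%:R^-1%:E * \sum_(i < N) f (tnth x i).
Proof.
move=> mf f0; rewrite /empirical ge0_integral_mscale//=.
rewrite ge0_integral_measure_sum//; congr (_ * _); apply: eq_bigr => i _.
by rewrite integral_dirac// diracT mul1e (tnth_nth 0%R).
Qed.

(** Both parts of [g] integrate to finite sums of reals, so their difference is legitimate for any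
    measurable [g]. *)
Lemma integral_empirical N (x : N.-tuple 'rV[R]_d) (g : 'rV[R]_d -> R) :
    measurable_fun setT g ->
  \int[empirical x]_v (g v)%:E = (N%:R^-1 * \sum_(i < N) g (tnth x i))%:E.
Proof.
move=> mg; rewrite integralE.
have mE : measurable_fun setT (EFin \o g) by exact/measurable_EFinP.
rewrite (ge0_integral_empirical _ (measurable_funepos mE))//.
rewrite (ge0_integral_empirical _ (measurable_funeneg mE))//.
under eq_bigr do rewrite funeposE -EFin_max.
under [X in _ - _ * X]eq_bigr do rewrite funenegE -EFinN -EFin_max.
rewrite !sumEFin -!EFinM -EFinB -mulrBr -sumrB; congr (_ * _)%:E.
apply: eq_bigr => i _; have [g0|/ltW g0] := leP 0%R (g (tnth x i)).
  by rewrite max_r ?oppr_le0// subr0.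
by rewrite max_l ?oppr_ge0// sub0r opprK.
Qed.

Lemma empirical_setT N (x : N.-tuple 'rV[R]_d) : (0 < N)%N ->
  empirical x setT = 1.
Proof.
move=> N0; have := @integral_empirical N x (cst 1%R) (measurable_cst _).
rewrite (_ : \int[_]_v _ = 1%:E * empirical x setT); last first.
  exact: (integral_cst (empirical x) measurableT 1%:E).
rewrite mul1e => ->; rewrite sumr_const card_ord mulVf//.
by rewrite pnatr_eq0 -lt0n.
Qed.

Lemma P2_empirical N (x : N.-tuple 'rV[R]_d) (X : set 'rV[R]_d)
    (P : probability 'rV[R]_d R) : (0 < N)%N -> measurable X ->
    (forall i, X (tnth x i)) -> (forall A, P A = empirical x A) -> P2 X P.
Proof.
move=> N0 mX Xx PE; split.
  rewrite PE -(setIT X) -integral_indic// integral_empirical//.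
  under eq_bigr do rewrite indicE mem_set//.
  by rewrite sumr_const card_ord mulVf// pnatr_eq0 -lt0n.
rewrite (eq_measure_integral (empirical x)); last by move=> A _ _; exact: PE.
by rewrite integral_empirical ?ltry//; exact: measurable_norm2_sqr.
Qed.

End empirical_measure.

Section mixture_measure.
Context {R : realType} {d : nat}.
Implicit Types mu : probability 'rV[R]_d R.
Local Open Scope ereal_scope.

Lemma integrable_mscale e (T : measurableType e) (k : {nonneg R})
    (mu : {measure set T -> \bar R}) (g : T -> R) :
    mu.-integrable setT (EFin \o g) ->
  (mscale k mu).-integrable setT (EFin \o g).
Proof.
move=> /integrableP[mg gi]; apply/integrableP; split => //.
rewrite ge0_integral_mscale//; last exact: measurableT_comp.
by rewrite lte_mul_pinfty.
Qed.

Lemma integral_mscale e (T : measurableType e) (k : {nonneg R})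
    (mu : {measure set T -> \bar R}) (g : T -> R) :
    mu.-integrable setT (EFin \o g) ->
  \int[mscale k mu]_x (g x)%:E = k%:num%:E * \int[mu]_x (g x)%:E.
Proof.
move=> gi; have mg := measurable_int _ gi.
have posE := ge0_integral_mscale mu measurableT k (measurable_funepos mg)
  (fun x _ => funepos_ge0 _ x).
have negE := ge0_integral_mscale mu measurableT k (measurable_funeneg mg)
  (fun x _ => funeneg_ge0 _ x).
transitivity (\int[mscale k mu]_x (EFin \o g)^\+ x -
  \int[mscale k mu]_x (EFin \o g)^\- x); first exact: integralE.
rewrite posE negE -muleBr//; first by congr (_ * _); exact/esym/integralE.
by rewrite fin_num_adde_defr//; exact: integrable_pos_fin_num.
Qed.

Lemma integral_mixture (e : R) mu mu' (g : 'rV[R]_d -> R) :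
    (0 <= e <= 1)%R -> mu.-integrable setT (EFin \o g) ->
    mu'.-integrable setT (EFin \o g) ->
  \int[mixture e mu mu']_x (g x)%:E =
  (1 - e)%:E * \int[mu]_x (g x)%:E + e%:E * \int[mu']_x (g x)%:E.
Proof.
move=> /andP[e0 e1] gi gi'; rewrite /mixture integral_measure_add//.
- by rewrite !integral_mscale//= !ger0_norm ?subr_ge0.
- exact: integrable_mscale.
- exact: integrable_mscale.
Qed.

End mixture_measure.

(** * Convexity of the risk and its first variation *)

Section risk_theory.
Context {R : realType} {d m n : nat} {D Y : Type}.
Variables (X : set 'rV[R]_d) (mX : measurable X).
Variables (h : 'rV[R]_d -> D -> 'rV[R]_m).
Variables (l : 'rV[R]_m -> Y -> R) (z : 'I_n -> D) (y : 'I_n -> Y).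
Implicit Types mu : probability 'rV[R]_d R.
Local Notation F := (risk X h l z y).
Local Notation hX w k := ((fun x => h x w ord0 k) \_ X).

(** Functions controlled on [X] only are extended by 0, so that all later integrals run over the
    whole space. *)
Lemma mean_hE (mu : {measure set 'rV[R]_d -> \bar R}) w k :
  mean_h X h mu w ord0 k = fine (\int[mu]_x (hX w k x)%:E).
Proof. by rewrite mxE Rintegral_mkcond. Qed.

Lemma eq_risk (mu mu' : {measure set 'rV[R]_d -> \bar R}) :
  (forall A, mu A = mu' A) -> F mu = F mu'.
Proof.
move=> mumu'; congr (_ * _); apply: eq_bigr => j _; congr l.
apply/rowP => k; rewrite !mxE; congr fine.
by apply: eq_measure_integral => A _ _.
Qed.

Lemma integrable_restrict_EFin (mu : {measure set 'rV[R]_d -> \bar R})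
    (g : 'rV[R]_d -> R) : mu.-integrable X (EFin \o g) ->
  mu.-integrable setT (EFin \o (g \_ X)).
Proof.
move=> /(integrable_mkcond _ mX); apply: eq_integrable => // x _.
by rewrite /= restrict_EFin.
Qed.

Hypothesis l_convex : forall v, convex_function setT (l^~ v).

(** The mean of [h] is affine along the mixture and [l] is convex, so the difference quotient is at
    most its value at [e = 1]. *)
Lemma risk_mixture_le (e : R) mu mu' : 0 < e <= 1 ->
    (forall w k, mu.-integrable X (fun x => (h x w ord0 k)%:E)) ->
    (forall w k, mu'.-integrable X (fun x => (h x w ord0 k)%:E)) ->
  e^-1 * (F (mixture e mu mu') - F mu) <= F mu' - F mu.
Proof.
move=> /andP[e0 e1] hmu hmu'.
rewrite ler_pdivrMl//.
suff : F (mixture e mu mu') <= e * F mu' + (1 - e) * F mu by lra.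
have hi w k : mu.-integrable setT (EFin \o hX w k).
  by apply: integrable_restrict_EFin; exact: hmu.
have hi' w k : mu'.-integrable setT (EFin \o hX w k).
  by apply: integrable_restrict_EFin; exact: hmu'.
have e01 : 0 <= e <= 1 by rewrite ltW.
have mixE w : mean_h X h (mixture e mu mu') w =
    e *: mean_h X h mu' w + (1 - e) *: mean_h X h mu w.
  apply/rowP => k.
  transitivity (e * mean_h X h mu' w ord0 k + (1 - e) * mean_h X h mu w ord0 k);
    last by rewrite [RHS]mxE; congr (_ + _); rewrite [RHS]mxE.
  rewrite !mean_hE.
  rewrite (integral_mixture e01 (hi w k) (hi' w k)).
  have fi : (\int[mu]_x (hX w k x)%:E)%E \is a fin_num.
    exact: (integrable_fin_num measurableT (hi w k)).
  have fi' : (\int[mu']_x (hX w k x)%:E)%E \is a fin_num.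
    exact: (integrable_fin_num measurableT (hi' w k)).
  by rewrite fineD ?fin_numM// !fineM// addrC.
rewrite /risk (mulrCA e) (mulrCA (1 - e)) -mulrDr ler_wpM2l//.
rewrite !mulr_sumr -big_split/=; apply: ler_sum => j _; rewrite mixE.
by have /= := l_convex (y j) (Itv01 (ltW e0) e1)
  (in_setT (mean_h X h mu' (z j))) (in_setT (mean_h X h mu (z j))).
Qed.

(** The tangent inequality of a convex function: let [e] tend to 0 from the right in
    [risk_mixture_le]. *)
Lemma first_variation_le (V : 'rV[R]_d -> R) mu mu' :
    first_variation X F mu V -> P2 X mu' ->
    (forall w k, mu.-integrable X (fun x => (h x w ord0 k)%:E)) ->
    (forall w k, mu'.-integrable X (fun x => (h x w ord0 k)%:E)) ->
  \int[mu']_(x in X) V x - \int[mu]_(x in X) V x <= F mu' - F mu.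
Proof.
move=> [_ FV] P2mu' hmu hmu'; have [_ _ VF] := FV _ P2mu'.
apply: (cvgr_to_le VF); near=> e.
apply: risk_mixture_le => //; apply/andP; split; near: e.
  exact: nbhs_right_gt.
exact: nbhs_right_le.
Unshelve. all: by end_near. Qed.

End risk_theory.

(** * Bounds on the risk of an empirical measure *)

Section empirical_risk.
Context {R : realType} {d m n : nat} {D Y : Type}.
Variables (X : set 'rV[R]_d) (mX : measurable X).
Variables (h : 'rV[R]_d -> D -> 'rV[R]_m).
Variables (l : 'rV[R]_m -> Y -> R) (z : 'I_n -> D) (y : 'I_n -> Y).
Local Notation F := (risk X h l z y).
Local Notation hX w k := ((fun x => h x w ord0 k) \_ X).
Variable mu : probability 'rV[R]_d R.
Hypothesis hmu :
  forall w k, mu.-integrable X (fun x => (h x w ord0 k)%:E).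

Let hi w k : mu.-integrable setT (EFin \o hX w k).
Proof. by apply: integrable_restrict_EFin => //; exact: hmu. Qed.

Let mh w k : measurable_fun setT (hX w k).
Proof. by apply/measurable_EFinP; exact: measurable_int (hi w k). Qed.

Lemma mean_h_empirical N (t : N.-tuple 'rV[R]_d) w k :
  mean_h X h (empirical t) w ord0 k =
  N%:R^-1 * \sum_(i < N) hX w k (tnth t i).
Proof. by rewrite mean_hE integral_empirical. Qed.

Lemma measurable_risk_empirical N : (forall v, continuous (l^~ v)) ->
  measurable_fun setT (fun t : N.-tuple 'rV[R]_d => F (empirical t)).
Proof.
move=> cl; apply: measurable_funM => //; apply: measurable_sum => j.
apply: (measurableT_comp (continuous_measurable_mx (cl (y j)))).
apply: measurable_fun_row => k; under eq_fun do rewrite mean_h_empirical.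
apply: measurable_funM => //; apply: measurable_sum => i.
by apply: measurableT_comp; [exact: mh|exact: measurable_tnth].
Qed.

(** The tangent inequality at [mu] allows singular competitors, in particular the empirical measure,
    against which [V] integrates to an average; then multiply by N. *)
Lemma risk_empirical_ge (V : 'rV[R]_d -> R) N (t : N.-tuple 'rV[R]_d) :
    (0 < N)%N ->
    (forall v, convex_function setT (l^~ v)) -> first_variation X F mu V ->
    (forall (mu' : probability 'rV[R]_d R) w k, P2 X mu' ->
      mu'.-integrable X (fun x => (h x w ord0 k)%:E)) ->
    measurable_fun setT (V \_ X) -> (forall i, X (tnth t i)) ->
  N%:R * (F mu - \int[mu]_(x in X) V x) + \sum_(i < N) V (tnth t i) <=
  N%:R * F (empirical t).
Proof.
move=> N0 lconv FV hint mV Xt.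
have [P PE] := measure_probability (empirical_setT t N0).
have P2P := P2_empirical N0 mX Xt PE.
have := first_variation_le mX lconv FV P2P hmu (fun w k => hint P w k P2P).
have FE : F P = F (empirical t) by exact: eq_risk.
rewrite FE.
rewrite (_ : \int[P]_(x in X) V x = N%:R^-1 * \sum_(i < N) V (tnth t i)).
  have N0R : 0 < N%:R :> R by rewrite ltr0n.
  rewrite lerBlDr -(ler_pM2l N0R) !mulrDr !mulrN mulVKf ?gt_eqF//; lra.
rewrite Rintegral_mkcond /Rintegral (eq_measure_integral (empirical t)).
  rewrite integral_empirical//=; congr (_ * _); apply: eq_bigr => i _.
  by rewrite patchE mem_set.
by move=> A _ _; exact: PE.
Qed.

Section variance.
Variables (N : nat) (N0 : (0 < N)%N) (n0 : (0 < n)%N) (L rho : R).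
Hypothesis L0 : 0 < L.
Hypothesis l_smooth : forall a b v,
    l b v <= l a v + dot (grad (l^~ v) a) (b - a)
             + L / 2 * norm2 (b - a) ^+ 2.
Hypothesis h_bounded : forall w,
    (\int[mu]_(x in X) (norm2 (h x w) ^+ 2)%:E <= (rho ^+ 2)%:E)%E.

(** The empirical mean of [h] deviates from [a j] by [S j k t / N] in coordinate [k]. Hence a factor
    N^-1 in the linear coefficient [alpha] and N^-2 in the quadratic coefficient [beta], besides
    n^-1 from the average over the data. *)
Let a j := mean_h X h mu (z j).
Let g j k x := hX (z j) k x - a j ord0 k.
Let S j k (t : N.-tuple 'rV[R]_d) := \sum_(i < N) g j k (tnth t i).
Let alpha j k := n%:R^-1 * (N%:R^-1 * grad (l^~ (y j)) (a j) ord0 k).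
Let beta := n%:R^-1 * (L / 2 * N%:R^-1 ^+ 2).

(* The upper bound on the risk of an empirical measure that comes from the
   smoothness of [l] at the means [a j], written in coordinates. *)
Definition risk_upper (t : N.-tuple 'rV[R]_d) : R :=
  F mu + \sum_j \sum_k (alpha j k * S j k t + beta * S j k t ^+ 2).

Lemma risk_empirical_le t : F (empirical t) <= risk_upper t.
Proof.
rewrite /risk_upper /risk -subr_ge0.
rewrite [X in _ + X - _](_ : _ = n%:R^-1 * \sum_j \sum_k
    (N%:R^-1 * grad (l^~ (y j)) (a j) ord0 k * S j k t +
     L / 2 * N%:R^-1 ^+ 2 * S j k t ^+ 2)); last first.
  rewrite mulr_sumr; apply: eq_bigr => j _; rewrite mulr_sumr.
  by apply: eq_bigr => k _; rewrite mulrDr /alpha /beta !mulrA.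
rewrite -mulrDr -mulrBr mulr_ge0//.
rewrite -big_split/= -sumrB; apply: sumr_ge0 => j _; rewrite subr_ge0.
apply: (le_trans (l_smooth (a j) _ _)); rewrite -addrA lerD2l.
have SE k : (mean_h X h (empirical t) (z j) - a j) ord0 k = N%:R^-1 * S j k t.
  rewrite mxE [X in _ + X]mxE mean_h_empirical /S /g sumrB mulrBr.
  congr (_ - _); rewrite sumr_const card_ord -[X in _ = _ * X]mulr_natl.
  by rewrite mulKf// pnatr_eq0 -lt0n.
rewrite dot_sum norm2_sqr_rV mulr_sumr -big_split/= le_eqVlt; apply/orP; left.
apply/eqP; apply: eq_bigr => k _; rewrite !SE exprMn.
by rewrite !mulrA; congr (_ * _ + _); rewrite mulrC.
Qed.

Let meanE w k : (\int[mu]_x (hX w k x)%:E = (mean_h X h mu w ord0 k)%:E)%E.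
Proof.
by rewrite mean_hE fineK//; exact: (integrable_fin_num measurableT (hi w k)).
Qed.

Let sum_sqr_integral w :
  (\int[mu]_x (\sum_k hX w k x ^+ 2)%:E <= (rho ^+ 2)%:E)%E.
Proof.
apply: le_trans (h_bounded w); rewrite [leRHS]integral_mkcond.
rewrite le_eqVlt; apply/orP; left; apply/eqP; apply: eq_integral => x _.
rewrite patchE norm2_sqr_rV; case: ifPn => xX.
  by congr EFin; apply: eq_bigr => k _; rewrite patchE xX.
congr EFin; apply: big1 => k _; rewrite patchE (negbTE xX).
by rewrite expr0n.
Qed.

(** Each squared coordinate is dominated by the squared norm, of integral at most [rho ^+ 2]. *)
Let hsqr_i w k : mu.-integrable setT (EFin \o (fun x => hX w k x ^+ 2)).
Proof.
have sum_i : mu.-integrable setT (EFin \o (fun x => \sum_k hX w k x ^+ 2)).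
  apply/integrableP; split.
    apply/measurable_EFinP; apply: measurable_sum => k'.
    by apply: measurable_funX; exact: mh.
  apply: le_lt_trans (ltry (rho ^+ 2)); apply: le_trans (sum_sqr_integral w).
  rewrite le_eqVlt; apply/orP; left; apply/eqP; apply: eq_integral => x _.
  by rewrite /= ger0_norm// sumr_ge0// => k' _; exact: sqr_ge0.
apply: le_integrable sum_i => //.
  by apply/measurable_EFinP; apply: measurable_funX; exact: mh.
move=> x _ /=; rewrite lee_fin ger0_norm ?sqr_ge0// ger0_norm; last first.
  by rewrite sumr_ge0// => k' _; exact: sqr_ge0.
rewrite (bigD1 k)//= lerDl sumr_ge0// => k' _; exact: sqr_ge0.
Qed.

Let mu1 : mu setT = 1%E := probability_setT mu.

Let gi j k : mu.-integrable setT (EFin \o g j k).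
Proof.
exact: (integrable_addr (hi _ _)
  (integrable_cst_probability (- a j ord0 k) mu1)).
Qed.

Let g0 j k : (\int[mu]_x (g j k x)%:E = 0)%E.
Proof.
rewrite (integral_addr (hi _ _)
  (integrable_cst_probability (- a j ord0 k) mu1)).
rewrite (integral_cst_probability _ mu1).
by rewrite meanE -EFinD subrr.
Qed.

Let gsqrE j k x :
  g j k x ^+ 2 =
  hX (z j) k x ^+ 2 + (-2 * a j ord0 k * hX (z j) k x + a j ord0 k ^+ 2).
Proof. by rewrite /g; ring. Qed.

Let gsqr_i j k : mu.-integrable setT (EFin \o (fun x => g j k x ^+ 2)).
Proof.
under eq_fun do rewrite /= gsqrE.
apply: integrable_addr; first exact: hsqr_i.
apply: integrable_addr; last exact: integrable_cst_probability.
exact: integrable_mulr.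
Qed.

(** A variance is the second moment minus the squared mean. *)
Let gsqr_le j k :
  (\int[mu]_x (g j k x ^+ 2)%:E <= \int[mu]_x (hX (z j) k x ^+ 2)%:E)%E.
Proof.
under eq_integral do rewrite gsqrE.
have ci := integrable_cst_probability (a j ord0 k ^+ 2) mu1.
have li := integrable_mulr (-2 * a j ord0 k) (hi (z j) k).
rewrite (integral_addr (hsqr_i _ _) (integrable_addr li ci)).
rewrite (integral_addr li ci) (integral_mulr _ (hi _ _)) meanE.
rewrite (integral_cst_probability _ mu1) -EFinM -EFinD geeDl// lee_fin.
rewrite -/(a j) (_ : _ + _ = - a j ord0 k ^+ 2) ?oppr_le0 ?sqr_ge0//.
by ring.
Qed.

Let Q := power_measure mu N.

Lemma integrable_risk_upper : Q.-integrable setT (EFin \o risk_upper).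
Proof.
apply: integrable_addr.
  exact: (integrable_cst_probability _ (power_measure_setT mu N)).
apply: integrable_sumr => j; apply: integrable_sumr => k.
apply: integrable_addr; apply: integrable_mulr.
  exact: integrable_power_measure_sum.
exact: (integral_power_measure_sum_sqr N (gi j k) (g0 j k) (gsqr_i j k)).1.
Qed.

(** The centred sums have mean 0, which kills the linear terms; a square contributes [beta * N%:R]
    times a variance, and summing the variances over coordinates gives at most [rho ^+ 2]. *)
Lemma integral_risk_upper :
  (\int[Q]_t (risk_upper t)%:E <= (F mu + L * rho ^+ 2 / (2 * N%:R))%:E)%E.
Proof.
have Q1 := power_measure_setT mu N.
have si j k : Q.-integrable setT (EFin \o S j k).
  exact: integrable_power_measure_sum.
have s2 j k := integral_power_measure_sum_sqr N (gi j k) (g0 j k) (gsqr_i j k).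
have s2i j k : Q.-integrable setT (EFin \o (fun t => S j k t ^+ 2)).
  exact: (s2 j k).1.
have ui j k : Q.-integrable setT
    (EFin \o (fun t => alpha j k * S j k t + beta * S j k t ^+ 2)).
  by apply: integrable_addr; apply: integrable_mulr.
have uiE j k :
    (\int[Q]_t (alpha j k * S j k t + beta * S j k t ^+ 2)%:E =
     (beta * N%:R)%:E * \int[mu]_x (g j k x ^+ 2)%:E)%E.
  rewrite (integral_addr (integrable_mulr _ (si j k))
    (integrable_mulr _ (s2i j k))).
  rewrite (integral_mulr _ (si j k)) (integral_mulr _ (s2i j k)).
  rewrite [X in (_ * X + _)%E](integral_power_measure_sum N (gi j k)) g0.
  by rewrite !mule0 add0e [X in (_ * X)%E](s2 j k).2 muleA -EFinM.
rewrite (integral_addr (integrable_cst_probability _ Q1)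
  (integrable_sumr _ (fun j => integrable_sumr _ (ui j)))).
rewrite (integral_cst_probability _ Q1) EFinD leeD2lE//.
rewrite (integral_sumr _ (fun j => integrable_sumr _ (ui j))).
have N0R : N%:R != 0 :> R by rewrite pnatr_eq0 -lt0n.
have n0R : n%:R != 0 :> R by rewrite pnatr_eq0 -lt0n.
(* The bound is cut into n equal shares, one per data point: [beta * N%:R] is L / (2 n N). *)
rewrite (_ : L * rho ^+ 2 / (2 * N%:R) =
    \sum_(j < n) beta * N%:R * rho ^+ 2); last first.
  rewrite sumr_const card_ord -[RHS]mulr_natl /beta.
  by field; rewrite n0R N0R.
rewrite -sumEFin; apply: lee_sum => j _.
rewrite (integral_sumr _ (ui j)) EFinM.
have bN0 : 0 <= beta * N%:R.
  by rewrite /beta !mulr_ge0// ?invr_ge0 ?divr_ge0// ltW.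
apply: (@le_trans _ _ ((beta * N%:R)%:E *
    \int[mu]_x (\sum_k hX (z j) k x ^+ 2)%:E)%E); last first.
  by apply: lee_wpmul2l => //; rewrite lee_fin.
rewrite (integral_sumr _ (hsqr_i (z j))) ge0_sume_distrr; last first.
  by move=> k _; apply: integral_ge0 => x _; rewrite lee_fin sqr_ge0.
by apply: lee_sum => k _; rewrite uiE; apply: lee_wpmul2l; rewrite ?lee_fin.
Qed.

End variance.

End empirical_risk.

(** * Almost sure statements and absolute continuity *)

Section almost_sure.
Context d (T : measurableType d) (R : realType).
Local Open Scope ereal_scope.

Lemma probability_aeP (P : probability T R) (E : set T) : measurable E ->
  P E = 1 <-> {ae P, forall x, E x}.
Proof.
move=> mE; split=> [PE|[A [mA A0 sA]]].
  exists (~` E); split => //; first exact: measurableC.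
  by rewrite probability_setC// PE subee.
have PC : P (~` E) = 0.
  by apply: (subset_measure0 _ mA _ A0) => //; exact: measurableC.
have := probability_setC P mE; rewrite PC => /esym/eqP.
by rewrite sube_eq ?fin_num_adde_defl ?fin_num_measure// add0e => /eqP.
Qed.

Lemma integrable_integral_defined (P : probability T R) (f : T -> \bar R) :
  P.-integrable setT f -> integral_defined P f.
Proof.
move=> fi; rewrite /integral_defined fin_num_adde_defr//.
exact: integrable_pos_fin_num.
Qed.

Lemma ae_eq_integrable (mu : {measure set T -> \bar R}) (f g : T -> \bar R) :
    measurable_fun setT f -> mu.-integrable setT g -> ae_eq mu setT f g ->
  mu.-integrable setT f.
Proof.
move=> mf /integrableP[mg gi] fg; apply/integrableP; split => //.
rewrite (ae_eq_integral (abse \o g))//; [exact: measurableT_comp..|].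
exact: ae_eq_abse.
Qed.

Lemma measurable_tuple_set N (X : set T) : measurable X ->
  measurable [set t : N.-tuple T | forall i, X (tnth t i)].
Proof.
move=> mX; rewrite (_ : [set _ | _] =
    \bigcap_(i : 'I_N) ((fun t => tnth t i) @^-1` X)).
  apply: fin_bigcap_measurable => // i _; rewrite -[X in measurable X]setTI.
  exact: (@measurable_tnth _ T N i measurableT).
by apply/seteqP; split => [t Xt i _|t Xt i]; [exact: Xt|exact: (Xt i Logic.I)].
Qed.

(** If [Q A = 0] then [p] vanishes [nu]-almost everywhere on [A], so the part of [A] in [E] is
    [nu]-null, hence [mu]-null; the part outside [E] is [mu]-null by [aeE]. *)
Lemma dominates_has_density (nu Q : {measure set T -> \bar R})
    (mu : probability T R) p (E : set T) : has_density nu Q p ->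
    mu `<< nu -> {ae mu, forall x, E x} -> (forall x, E x -> (p x != 0)%R) ->
  mu `<< Q.
Proof.
move=> [mp p0 QE] munu aeE pE; apply/null_content_dominatesP => A mA QA0.
have mpA : measurable_fun A (EFin \o p).
  by apply/measurable_EFinP; exact: measurable_funTS.
have [B [mB nuB sB]] : ae_eq nu A (EFin \o p) (cst 0).
  apply/ae_eq_integral_abs => //; transitivity (Q A); last exact: QA0.
  by rewrite QE//; apply: eq_integral => x _; rewrite /= ger0_norm.
have muB : mu B = 0 by move/null_content_dominatesP: munu; exact.
have [C [mC muC sC]] := aeE.
apply: (subset_measure0 mA (measurableU _ _ mB mC)); last first.
  apply/eqP; rewrite -measure_le0; apply: (le_trans (measureU2 _ mB mC)).
  by rewrite [X in X + _]muB [X in _ + X]muC adde0.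
move=> x Ax; have [Ex|nEx] := pselect (E x); last by right; exact: sC.
left; apply: sB => /= /(_ Ax) [] /eqP; apply/negP; exact: pE.
Qed.

End almost_sure.

(** * The Gibbs density, its powers and their entropies *)

Section product_gibbs.
Context {R : realType} {d : nat}.
Variables (X : set 'rV[R]_d) (mX : measurable X) (lam Z : R).
Hypothesis Z0 : 0 < Z.
Variables (V : 'rV[R]_d -> R) (mu : probability 'rV[R]_d R).
Hypothesis Vi : mu.-integrable X (EFin \o V).
Hypothesis muX : mu X = 1%E.
Hypothesis muE : forall A, measurable A ->
  mu A = (\int[lebesgue_rV]_(x in A `&` X) (expR (- (lam^-1 * V x)) / Z)%:E)%E.

Definition gibbs_density : 'rV[R]_d -> R :=
  (fun x => expR (- (lam^-1 * V x)) / Z) \_ X.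

Let p := gibbs_density.
Let ent : R := - (lam^-1 * (\int[mu]_(x in X) V x)) - ln Z.
(** Matches [ln (p x)] on [X], which has full mass, and is [- ln Z] elsewhere; being affine in
    [V \_ X], it is integrable over the whole space, with mean [ent]. *)
Let lnp x : R := - lam^-1 * (V \_ X) x - ln Z.

Let VXi : mu.-integrable setT (EFin \o (V \_ X)).
Proof. exact: integrable_restrict_EFin. Qed.

Lemma measurable_potential : measurable_fun setT (V \_ X).
Proof. by apply/measurable_EFinP; exact: measurable_int VXi. Qed.

Lemma ln_gibbs_density x : X x -> ln (p x) = lnp x.
Proof.
move=> Xx; rewrite /p /gibbs_density /lnp !patchE mem_set//.
by rewrite ln_div ?posrE ?expR_gt0// expRK mulNr.
Qed.

Lemma gibbs_density_neq0 x : p x != 0 <-> X x.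
Proof.
rewrite /p /gibbs_density patchE; case: ifPn => [|].
  rewrite inE => Xx; split => // _.
  by rewrite mulf_neq0// ?gt_eqF ?expR_gt0 ?invr_gt0.
by rewrite notin_setE eqxx.
Qed.

Lemma gibbs_has_density : has_density (@lebesgue_rV R d) mu p.
Proof.
split => [|x|A mA].
- rewrite /p /gibbs_density; apply/(measurable_restrictT _ mX).
  apply: measurable_funM => //; apply: measurableT_comp => //.
  apply: measurableT_comp => //; apply: measurable_funM => //.
  by apply/measurable_EFinP; exact: measurable_int Vi.
- rewrite /p /gibbs_density patchE; case: ifPn => // _.
  by rewrite divr_ge0 ?expR_ge0// ltW.
- rewrite muE// integral_mkcondr; apply: eq_integral => x _.
  by rewrite restrict_EFin.
Qed.

Let lnp_i : mu.-integrable setT (EFin \o lnp).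
Proof.
apply: integrable_addr; first exact: integrable_mulr.
exact: (integrable_cst_probability (- ln Z) (probability_setT mu)).
Qed.

Let integral_lnp : (\int[mu]_x (lnp x)%:E = ent%:E)%E.
Proof.
have c_i := integrable_cst_probability (- ln Z) (probability_setT mu).
rewrite (integral_addr (integrable_mulr (- lam^-1) VXi) c_i).
rewrite (integral_cst_probability _ (probability_setT mu)).
rewrite (integral_mulr _ VXi) /ent Rintegral_mkcond /Rintegral.
have Vfin := integrable_fin_num measurableT VXi.
by rewrite -mulNr EFinB EFinM fineK.
Qed.

Lemma entropy_gibbs : entropy lebesgue_rV mu = ent%:E.
Proof.
rewrite (entropy_has_density gibbs_has_density) -integral_lnp.
apply: ae_eq_integral => //.
- apply/measurable_EFinP; apply: measurableT_comp => //.
  by case: gibbs_has_density.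
- exact: measurable_int lnp_i.
- have /(probability_aeP _ mX) := muX.
  by apply: filterS => x Xx _ /=; rewrite ln_gibbs_density.
Qed.

Variables (N : nat) (Q : probability (N.-tuple 'rV[R]_d) R).
Hypothesis QE : forall A, Q A = power_measure mu N A.

Let P (t : N.-tuple 'rV[R]_d) := \prod_(i < N) p (tnth t i).

Lemma product_gibbs_has_density :
  has_density (power_measure (@lebesgue_rV R d) N) (power_measure mu N) P.
Proof. exact: has_density_power_measure gibbs_has_density. Qed.

Let XN := [set t : N.-tuple 'rV[R]_d | forall i, X (tnth t i)].

Lemma product_gibbs_density_neq0 t : P t != 0 <-> XN t.
Proof.
rewrite /P; split=> [/prodf_neq0 h i|Xt].
  by apply/gibbs_density_neq0; exact: h.
by apply/prodf_neq0 => i _; apply/gibbs_density_neq0; exact: Xt.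
Qed.

Lemma ln_product_gibbs_density t : XN t ->
  ln (P t) = \sum_(i < N) lnp (tnth t i).
Proof.
move=> Xt; have p_gt0 i : 0 < p (tnth t i).
  rewrite lt_neqAle eq_sym; have [_ p0 _] := gibbs_has_density.
  by rewrite p0 andbT; apply/gibbs_density_neq0.
transitivity (\sum_(i < N) ln (p (tnth t i))); last first.
  by apply: eq_bigr => i _; exact: ln_gibbs_density.
(* Positivity goes through the induction too, because [lnM] needs positive factors. *)
suff : 0 < P t /\ ln (P t) = \sum_(i < N) ln (p (tnth t i)) by case.
apply: (big_ind2 (fun x y => 0 < x /\ ln x = y)) => [|x1 y1 x2 y2|i _].
- by rewrite ltr01 ln1.
- by move=> [x10 <-] [x20 <-]; rewrite mulr_gt0// lnM.
- by split => //; exact: p_gt0.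
Qed.

Let Q_has_density : has_density (power_measure (@lebesgue_rV R d) N) Q P.
Proof.
by have [? ? PE] := product_gibbs_has_density; split => // A mA; rewrite -PE.
Qed.

Lemma product_gibbs_ae : {ae Q, forall t, XN t}.
Proof.
apply: filterS (has_density_ae_gt0 Q_has_density) => t Pt.
by apply/product_gibbs_density_neq0; rewrite gt_eqF.
Qed.

Lemma product_gibbs_on_product : on_product X Q.
Proof.
apply: (probability_aeP Q (measurable_tuple_set mX)).2.
exact: product_gibbs_ae.
Qed.

Let sum_lnp_i :
  Q.-integrable setT (fun t => (\sum_(i < N) lnp (tnth t i))%:E).
Proof.
exact: eq_measure_integrable QE (integrable_power_measure_sum N lnp_i).
Qed.

Lemma entropy_product_gibbs :
  entropy (power_measure lebesgue_rV N) Q = (N%:R * ent)%:E.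
Proof.
rewrite (entropy_has_density Q_has_density).
transitivity (\int[Q]_t (\sum_(i < N) lnp (tnth t i))%:E)%E.
  apply: ae_eq_integral => //.
  - apply/measurable_EFinP; apply: measurableT_comp => //.
    by case: Q_has_density.
  - exact: measurable_int sum_lnp_i.
  - apply: filterS product_gibbs_ae => t Xt _.
    by rewrite ln_product_gibbs_density.
rewrite (eq_measure_integral (power_measure mu N)); last first.
  by move=> A _ _; exact: QE.
by rewrite integral_power_measure_sum// integral_lnp -EFinM.
Qed.

(** Part of what makes the product measure an admissible competitor: its log-density is almost
    surely a sum of integrable terms. *)
Lemma entropy_defined_product_gibbs :
  entropy_defined (power_measure (@lebesgue_rV R d) N) Q.
Proof.
move=> Qnu; apply: integrable_integral_defined.
apply: (ae_eq_integrable _ sum_lnp_i); first exact: measurable_log_density.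
apply: filterS2 product_gibbs_ae (log_density_has_density Q_has_density).
by move=> t Xt lt _; rewrite lt ln_product_gibbs_density.
Qed.

End product_gibbs.

(** * The two bounds on the minimal energy *)

Theorem theorem4p1 (R : realType) (d : nat) (X : set 'rV[R]_d)
  (phi : 'rV[R]_d -> R)
  (Xconvex : convex_set (X : set (convex_lmodType 'rV[R]_d)))
  (phi_mirror : mirror_potential X phi)
  (lam : R) (lam_gt0 : 0 < lam) (N : nat) (N_gt0 : (0 < N)%N)
  (D Y : Type) (m n : nat) (n_gt0 : (0 < n)%N)
  (h : 'rV[R]_d -> D -> 'rV[R]_m) (l : 'rV[R]_m -> Y -> R)
  (z : 'I_n -> D) (y : 'I_n -> Y)
  (* the integrals h_mu are well defined on P2(X) *)
  (h_integrable : forall (mu : probability 'rV[R]_d R) (w : D) (k : 'I_m),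
    P2 X mu -> mu.-integrable X (fun x => (h x w ord0 k)%:E))
  (F := risk X h l z y)
  (* dF mu is the first variation of F at mu *)
  (dF : probability 'rV[R]_d R -> 'rV[R]_d -> R)
  (dF_variation : forall mu, P2 X mu -> first_variation X F mu (dF mu))
  (mu_ : probability 'rV[R]_d R)
  (mu_min : free_energy_minimizer X F lam mu_)
  (mu_gibbs : gibbs X (fun x => lam^-1 * dF mu_ x) mu_)
  (muN : probability (N.-tuple 'rV[R]_d) R)
  (muN_min : free_energyN_minimizer X F lam muN)
  (M1 M2 : R) (M1_gt0 : 0 < M1) (M2_gt0 : 0 < M2)
  (dF_diff : forall mu x, P2 X mu -> X x -> differentiable (dF mu) x)
  (dF_bounded : forall mu x, P2 X mu -> X x ->
    dual_norm phi x (grad (dF mu) x) <= M1)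
  (dF_lipschitz : forall mu mu' x x', P2 X mu -> P2 X mu' -> X x -> X x' ->
    ((dual_norm phi x' (grad (dF mu) x - grad (dF mu') x'))%:E <=
     M2%:E * (mirror_divergence X phi mu mu' +
              (dual_norm phi x' (grad phi x - grad phi x'))%:E))%E)
  (L : R) (L_gt0 : 0 < L)
  (l_convex : forall v, convex_function setT (l^~ v))
  (l_diff : forall a v, differentiable (l^~ v) a)
  (l_smooth : forall a b v,
    l b v <= l a v + dot (grad (l^~ v) a) (b - a)
             + L / 2 * norm2 (b - a) ^+ 2)
  (rho : R) (rho_gt0 : 0 < rho)
  (h_bounded : forall w,
    (\int[mu_]_(x in X) (norm2 (h x w) ^+ 2)%:E <= (rho ^+ 2)%:E)%E) :
  ((lam / N%:R)%:E * KL muN (power_measure mu_ N)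
     <= N%:R^-1%:E * free_energyN F lam muN - free_energy F lam mu_
     <= (L * rho ^+ 2 / (2 * N%:R))%:E)%E.
Proof.
have mX : measurable X.
  by apply: open_measurable_mx; exact: mirror_open phi_mirror.
have [P2mu mu_le] := mu_min.
have muX : mu_ X = 1%E by case: P2mu.
have FV := dF_variation _ P2mu.
have Vi : mu_.-integrable X (EFin \o dF mu_) by case: (FV.2 _ P2mu).
have hmu w k : mu_.-integrable X (fun x => (h x w ord0 k)%:E).
  exact: h_integrable.
have [Z Z0 muE] := mu_gibbs.
have [Q QE] := measure_probability (power_measure_setT mu_ N).
have cl v : continuous (l^~ v).
  by move=> a; apply: differentiable_continuous; exact: l_diff.
set v := \int[mu_]_(x in X) dF mu_ x.
set H0 := - (lam^-1 * v) - ln Z.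
pose G (t : N.-tuple 'rV[R]_d) := F (empirical t).
have mG : measurable_fun setT G by exact: measurable_risk_empirical.
have entE : entropy lebesgue_rV mu_ = H0%:E.
  by rewrite (entropy_gibbs mX Z0 Vi muX muE).
have LE : free_energy F lam mu_ = (F mu_ + lam * H0)%:E.
  by rewrite /free_energy entE -EFinM -EFinD.
have mXN := @measurable_tuple_set _ _ N X mX.
pose U := risk_upper X h l z y mu_ L (N := N).
have GU t : G t <= U t by exact: risk_empirical_le.
pose VX (t : N.-tuple 'rV[R]_d) := \sum_(i < N) (dF mu_ \_ X) (tnth t i).
have lowG t : (forall i, X (tnth t i)) ->
    N%:R * (F mu_ - v) + VX t <= N%:R * G t.
  move=> Xt; have := risk_empirical_ge mX hmu N_gt0 l_convex FV h_integrable
    (measurable_potential mX Vi) Xt.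
  rewrite (_ : \sum_(i < N) _ = VX t)//; apply: eq_bigr => i _.
  by rewrite patchE mem_set.
have N0R : 0 < N%:R :> R by rewrite ltr0n.
have Ui : Q.-integrable setT (EFin \o U).
  by apply: (eq_measure_integrable QE); exact: integrable_risk_upper.
have VXi : Q.-integrable setT (EFin \o VX).
  apply: (eq_measure_integrable QE); apply: integrable_power_measure_sum.
  exact: integrable_restrict_EFin.
have Q1 := probability_setT Q.
have aeQ := product_gibbs_ae mX Z0 Vi muE QE.
(* Under [Q] the risk lies almost surely between two integrable functions, the tangent minorant
   [lowG] and the smoothness majorant [U]. *)
have GQi : Q.-integrable setT (EFin \o G).
  apply: (integrable_mulrK N0R).
  have b_i := integrable_addr (integrable_norm (integrable_mulr N%:R Ui))
    (integrable_norm (integrable_addr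
      (integrable_cst_probability (N%:R * (F mu_ - v)) Q1) VXi)).
  apply: integrable_ae_le b_i _; first exact: measurable_funM.
  apply: filterS aeQ => t Xt /=; rewrite ler_norml.
  have := lowG t Xt; have : N%:R * G t <= N%:R * U t by rewrite ler_pM2l.
  have := ler_norm (N%:R * U t); have := normr_ge0 (N%:R * U t).
  have := ler_norm (- (N%:R * (F mu_ - v) + VX t)).
  have := normr_ge0 (N%:R * (F mu_ - v) + VX t); rewrite normrN.
  by move=> ? ? ? ? ? ?; apply/andP; split; lra.
have GQ_le : (\int[Q]_t (G t)%:E <= (F mu_ + L * rho ^+ 2 / (2 * N%:R))%:E)%E.
  apply: (@le_trans _ _ (\int[Q]_t (U t)%:E)%E).
    by apply: ae_le_integral => //; exact: aeW.
  rewrite (eq_measure_integral (power_measure mu_ N)); last first.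
    by move=> A _ _; exact: QE.
  exact: integral_risk_upper.
have [EQ EQE] : exists e : R, (\int[Q]_t (G t)%:E = e%:E)%E.
  exists (fine (\int[Q]_t (G t)%:E)); rewrite fineK//.
  exact: (integrable_fin_num measurableT GQi).
have EG (P : probability (N.-tuple 'rV[R]_d) R) :
    ('E_P[fun x => F (empirical x)] = \int[P]_t (G t)%:E)%E.
  by rewrite unlock.
have HQE : entropy (power_measure (@lebesgue_rV R d) N) Q = (N%:R * H0)%:E.
  exact: (entropy_product_gibbs mX Z0 Vi muE QE).
have LQ : free_energyN F lam Q = (N%:R * EQ + lam * (N%:R * H0))%:E.
  by rewrite /free_energyN EG EQE HQE -!EFinM -EFinD.
have Qdef : free_energyN_defined F lam Q.
  split.
  - exact: integrable_integral_defined GQi.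
  - exact: (entropy_defined_product_gibbs mX Z0 Vi muE QE).
  - by rewrite EG EQE HQE -!EFinM.
have [muN_on [Gdef Hdef sumdef] muN_le] := muN_min.
have LN_le := muN_le Q (product_gibbs_on_product mX Z0 Vi muE QE) Qdef.
have LN_lty : (free_energyN F lam muN < +oo)%E.
  by apply: le_lt_trans LN_le _; rewrite LQ ltry.
have aeN : {ae muN, forall t, forall i, X (tnth t i)}.
  exact/(probability_aeP _ mXN).
(* Otherwise the entropy of [muN] is +oo by convention, and so is its energy, contradicting
   [LN_lty]. *)
have muN_leb : muN `<< power_measure (@lebesgue_rV R d) N.
  apply: contrapT => nac; move: sumdef LN_lty; rewrite /free_energyN.
  have -> : entropy (power_measure (@lebesgue_rV R d) N) muN = +oo%E.
    by rewrite /entropy asboolF.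
  rewrite gt0_muley ?lte_fin//.
  by case: (_ * _)%E.
have PQ := product_gibbs_has_density mX Z0 Vi muE N.
(* The product density vanishes nowhere on the set of tuples with all entries in [X], where [muN]
   lives. *)
have muNQ : muN `<< power_measure mu_ N.
  apply: (dominates_has_density PQ muN_leb aeN) => t Xt.
  by apply/product_gibbs_density_neq0.
(* The left side equals that of [lowG]: [lam * H0] is [- v - lam * ln Z], and the terms in [ln Z]
   cancel against those of the N log-densities. *)
have lower : {ae muN, forall t, N%:R * (F mu_ + lam * H0) -
    lam * ln (\prod_(i < N) gibbs_density X lam Z (dF mu_) (tnth t i)) <=
    N%:R * G t}.
  apply: filterS aeN => t Xt; apply: le_trans (lowG t Xt).
  rewrite (ln_product_gibbs_density mX Z0 Vi muE)// sumrB -mulr_sumr -/(VX t).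
  rewrite sumr_const card_ord -[ln Z *+ N]mulr_natl /H0.
  rewrite le_eqVlt; apply/orP; left; apply/eqP.
  by field; rewrite gt_eqF.
have sumdefG := sumdef; rewrite EG in sumdefG.
have LN_ltyG := LN_lty; rewrite /free_energyN EG in LN_ltyG.
(* Here [a] is N and [c] is N times the free energy of [mu_], so [KL_le] is N times the lower
   bound. *)
have [K [E [H [KE EE HE KL_le]]]] := relative_entropy_le N0R lam_gt0
  (power_measure_setT mu_ N) PQ muNQ mG lower Gdef Hdef sumdefG LN_ltyG.
have LNE : free_energyN F lam muN = (N%:R * E + lam * H)%:E.
  by rewrite /free_energyN EG EE HE -!EFinM -EFinD.
rewrite KE LE LNE -!EFinM -EFinB !lee_fin.
move: LN_le; rewrite LNE LQ lee_fin => LN_le.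
move: GQ_le; rewrite EQE lee_fin => GQ_le.
set B := L * rho ^+ 2 / _ in GQ_le *.
apply/andP; split.
  rewrite -(ler_pM2l N0R) mulrA mulrCA divff ?gt_eqF// mulr1.
  rewrite mulrBr mulrA divff ?gt_eqF// mul1r; exact: KL_le.
(* By minimality [muN] may be replaced by [Q], whose entropy is exactly [N%:R * H0]; only the excess
   risk, at most [B], remains. *)
rewrite -(ler_pM2l N0R) mulrBr mulrA divff ?gt_eqF// mul1r.
have : N%:R * EQ <= N%:R * (F mu_ + B) by rewrite ler_pM2l.
by move: LN_le; lra.
Qed.
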